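(* Let $G_H$ be the (topological) Heisenberg group and let $\omega$ be a weight on $G_H$ of the form $$\omega(u,v,w)=W(|u|,|v|)\quad ((u,v,w)\in G_H)$$ for a function $W$ on $[0,\infty)\times[0,\infty)$. Suppose that $\lim_{(x,y)\to\infty}W(x,y)=\infty$. Then $L^1(G_H,\omega)$ is not weakly amenable.
   Context: The Heisenberg group $G_H$ is $\mathbb{R}^3$ with its Euclidean topology and the product $(u,v,w)(a,b,c)=(u+a,\,v+b,\,w+c+ub)$; Lebesgue measure is a Haar measure. A weight on a locally compact group $G$ is a continuous function $\omega:G\to(0,\infty)$ with $\omega(xy)\le\omega(x)\omega(y)$ for all $x,y\in G$ (continuity is a standing assumption). $L^1(G,\omega)=\{f: f\omega\in L^1(G)\}$ with norm $\|f\|_\omega=\int_G|f(x)|\omega(x)\,dx$ and convolution product is a Banach algebra. A Banach algebra $A$ is weakly amenable if every continuous derivation $D:A\to A^*$ (linear, $D(ab)=a\cdot D(b)+D(a)\cdot b$) is inner, i.e. of the form $a\mapsto a\cdot f-f\cdot a$ for some $f\in A^*$; here $A^*$ has the module actions $\langle x,a\cdot f\rangle=\langle xa,f\rangle$, $\langle x,f\cdot a\rangle=\langle ax,f\rangle$. *)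

(* Defs.v *)
From HB Require Import structures.
From mathcomp Require Import all_boot all_order all_algebra complex.
From mathcomp Require Import all_classical all_reals all_analysis.
From mathcomp Require Import measurable_realfun.
From mathcomp Require Import ring lra.

Set Implicit Arguments.
Unset Strict Implicit.
Unset Printing Implicit Defensive.
Import Order.TTheory GRing.Theory Num.Theory numFieldNormedType.Exports.
Local Open Scope classical_set_scope.
Local Open Scope ring_scope.

(* L^1-type algebras have no unit in general, so the product of A is passed
   explicitly instead of through a ring structure on A. *)
Section weak_amenability.
Context {K : numFieldType} (A : normedModType K) (mul : A -> A -> A).

Record dual := Dual {
  dual_fun :> {linear A -> K^o};
  dual_continuous : continuous dual_fun }.

Definition lact (a : A) (phi : dual) : A -> K := fun x => phi (mul x a).
Definition ract (phi : dual) (a : A) : A -> K := fun x => phi (mul a x).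

Definition linear_to_dual (D : A -> dual) : Prop :=
  forall (k : K) (a b x : A), D (k *: a + b) x = k * D a x + D b x.

(* continuity from A to its dual with the operator norm, i.e. with respect to
   uniform convergence on the unit ball *)
Definition continuous_to_dual (D : A -> dual) : Prop :=
  forall (a : A) (e : K), 0 < e ->
    \forall b \near a, forall x : A, `|x| <= 1 -> `|D b x - D a x| <= e.

Definition derivation (D : A -> dual) : Prop :=
  forall a b x : A, D (mul a b) x = lact a (D b) x + ract (D a) b x.

Definition inner (D : A -> dual) : Prop :=
  exists phi : dual, forall a x : A, D a x = lact a phi x - ract phi a x.

Definition weakly_amenable : Prop :=
  forall D : A -> dual,
    linear_to_dual D -> continuous_to_dual D -> derivation D -> inner D.

End weak_amenability.

Section heisenberg_group.
Context {R : realType}.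
Implicit Types x y z : R * R * R.

Definition hmul x y : R * R * R :=
  (x.1.1 + y.1.1, x.1.2 + y.1.2, x.2 + y.2 + x.1.1 * y.1.2).
Definition hone : R * R * R := (0, 0, 0).
Definition hinv x : R * R * R := (- x.1.1, - x.1.2, - x.2 + x.1.1 * x.1.2).

Lemma hmulA : associative hmul.
Proof. by move=> x y z; rewrite /hmul /=; congr (_, _, _); ring. Qed.

Lemma hmul1 : left_id hone hmul.
Proof. by move=> [[a b] c]; rewrite /hmul /=; congr (_, _, _); ring. Qed.

Lemma hmulVx : left_inverse hone hinv hmul.
Proof. by move=> [[a b] c]; rewrite /hmul /hone /=; congr (_, _, _); ring. Qed.

Lemma hmulxV : right_inverse hone hinv hmul.
Proof. by move=> [[a b] c]; rewrite /hmul /hone /=; congr (_, _, _); ring. Qed.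

End heisenberg_group.

Lemma sigma_finite_product d1 d2 (T1 : measurableType d1)
    (T2 : measurableType d2) (R : realType)
    (m1 : {sigma_finite_measure set T1 -> \bar R})
    (m2 : {sigma_finite_measure set T2 -> \bar R}) :
  sigma_finite setT (m1 \x m2)%E.
Proof.
have /sigma_finiteP[F [TF ndF Foo]] := sigma_finiteT m1.
have /sigma_finiteP[G [TG ndG Goo]] := sigma_finiteT m2.
exists (fun n => F n `*` G n).
 rewrite -setXTT TF TG predeqE => -[x y]; split.
    move=> [/= [n _ Fnx] [k _ Gky]]; exists (maxn n k) => //; split.
    - by move: x Fnx; exact/subsetPset/ndF/leq_maxl.
    - by move: y Gky; exact/subsetPset/ndG/leq_maxr.
  by move=> [n _ []/= ? ?]; split; exists n.
move=> k; have [? ?] := Foo k; have [? ?] := Goo k.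
split; first exact: measurableX.
by rewrite product_measure1E// lte_mul_pinfty// ge0_fin_numE.
Qed.

Local Notation L R := (measurableTypeR R).
Local Notation L2 R := (L R * L R)%type.
Local Notation L3 R := (L2 R * L R)%type.

(* The library's sigma-finite instance on [m1 \x m2] is shadowed by the one for
   probabilities, whence the named products below. *)
Definition lebesgue2 (R : realType) : set (L2 R) -> \bar R :=
  (@lebesgue_measure R \x @lebesgue_measure R)%E.
HB.instance Definition _ R := Measure.on (@lebesgue2 R).
HB.instance Definition _ R :=
  Measure_isSigmaFinite.Build _ _ _ (@lebesgue2 R)
    (sigma_finite_product (@lebesgue_measure R) (@lebesgue_measure R)).

(* Lebesgue measure on R^3. *)
Definition haar (R : realType) : set (L3 R) -> \bar R :=
  (@lebesgue2 R \x @lebesgue_measure R)%E.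
HB.instance Definition _ R := Measure.on (@haar R).
HB.instance Definition _ R :=
  Measure_isSigmaFinite.Build _ _ _ (@haar R)
    (sigma_finite_product (@lebesgue2 R) (@lebesgue_measure R)).

Section measurability.
Context {R : realType}.
Let box (c : rat * rat * rat) (n : nat) : set (R * R * R) :=
  [set x | `|x.1.1 - ratr c.1.1| < n.+1%:R^-1 /\
    `|x.1.2 - ratr c.1.2| < n.+1%:R^-1 /\ `|x.2 - ratr c.2| < n.+1%:R^-1].

Let id1 : L R -> R := id.
Let mid1 : measurable_fun setT id1. Proof. exact: measurable_id. Qed.

Lemma hfst_measurable : measurable_fun setT (fun x : L3 R => (x.1.1 : R)).
Proof.
apply: (@measurableT_comp _ _ _ _ _ _ id1) => //.
by apply: measurableT_comp => //.
Qed.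

Lemma hsnd_measurable : measurable_fun setT (fun x : L3 R => (x.1.2 : R)).
Proof.
apply: (@measurableT_comp _ _ _ _ _ _ id1) => //.
by apply: measurableT_comp => //.
Qed.

Lemma htrd_measurable : measurable_fun setT (fun x : L3 R => (x.2 : R)).
Proof.
by apply: (@measurableT_comp _ _ _ _ _ _ id1) => //.
Qed.

Let mbox c n : measurable (box c n : set (L3 R)).
Proof.
have mb (f : L3 R -> R) q e : measurable_fun setT f ->
    measurable [set x | `|f x - q| < e].
  move=> mf; rewrite (_ : [set x | _] = setT `&` f @^-1` `]q - e, q + e[).
    exact: mf.
  by rewrite setTI; apply/seteqP; split=> x /=; rewrite in_itv/= ltr_distl.
by rewrite /box; apply: measurableI; [|apply: measurableI];
  apply: mb; [exact: hfst_measurable|exact: hsnd_measurable|exact: htrd_measurable].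
Qed.

Lemma open_hmeasurable (U : set (R * R * R)) :
  open U -> measurable (U : set (L3 R)).
Proof.
move=> oU.
pose F a b c n := [set x | box (a, b, c) n x /\ box (a, b, c) n `<=` U].
have mF a b c n : measurable (F a b c n : set (L3 R)).
  have [bU|bU] := pselect (box (a, b, c) n `<=` U).
    rewrite (_ : F _ _ _ _ = box (a, b, c) n); first exact: mbox.
    by apply/seteqP; split=> [x []//|x bx]; split.
  rewrite (_ : F _ _ _ _ = set0); first exact: measurable0.
  by apply/seteqP; split=> [x []//|x].
suff -> : U = \bigcup_a \bigcup_b \bigcup_c \bigcup_n F a b c n.
  do 3 (apply: bigcupT_measurable_rat => ?); exact: bigcupT_measurable.
apply/seteqP; split; last first.
  by move=> x [a _ [b _ [c _ [n _ [bx]]]]]; apply.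
move=> x Ux.
have /nbhs_ballP[e /= e0 eU] : nbhs x U by exact: open_nbhs_nbhs.
pose n := Num.truncn (2 / e).
have n2 : n.+1%:R^-1 * 2 < e.
  rewrite mulrC ltr_pdivrMr// mulrC -ltr_pdivrMr//; exact: truncnS_gt.
have n0 : 0 < n.+1%:R^-1 :> R by rewrite invr_gt0.
have exq (r d : R) : 0 < d -> exists q : rat, `|r - ratr q| < d.
  move=> d0; have /rat_in_itvoo[q] : r - d < r + d by lra.
  rewrite in_itv/= => /andP[q1 q2]; exists q; rewrite ltr_norml.
  by apply/andP; split; lra.
have {}exq r := exq r _ n0.
have [a ha] := exq x.1.1; have [b hb] := exq x.1.2; have [c hc] := exq x.2.
exists a => //; exists b => //; exists c => //; exists n => //.
split => // y [/= ya [yb yc]]; apply: eU.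
have close (r s q d : R) : d * 2 < e -> `|r - q| < d -> `|s - q| < d ->
    `|r - s| < e.
  by rewrite !ltr_norml => de /andP[? ?] /andP[? ?]; apply/andP; split; lra.
by split; [split|]; rewrite /ball/=; apply: close n2 _ _; eassumption.
Qed.

Lemma continuous_hmeasurable (f : R * R * R -> R) :
  continuous f -> measurable_fun setT (f : L3 R -> R).
Proof.
move=> cf; apply: (measurability _ (measurable_realfun.RGenOpens.measurableE R)).
move=> _ [_ [a [b ->]] <-]; rewrite setTI; apply: open_hmeasurable.
apply: open_comp => [x _|]; [exact: cf|exact: interval_open].
Qed.

End measurability.

Section haar_invariance.
Context {R : realType}.
Local Open Scope ereal_scope.

Let shift_measurable (t : R) : measurable_fun setT (fun x : L R => (t + x)%R : L R).
Proof.
have : measurable_fun setT (fun x : L R => (t + x)%R : R).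
  by apply: measurable_funD => //; exact: measurable_id.
exact.
Qed.

Let integral_shift (t : R) (h : L R -> \bar R) : measurable_fun setT h ->
  (forall x, 0 <= h x) ->
  \int[@lebesgue_measure R]_x h (t + x)%R = \int[@lebesgue_measure R]_x h x.
Proof.
move=> mh h0.
pose m := pushforward (@lebesgue_measure R) (fun x : L R => (t + x)%R : L R).
transitivity (\int[m]_x h x).
  rewrite /m ge0_integral_pushforward//; exact: shift_measurable.
apply: eq_measure_integral => A mA _.
apply/esym/lebesgue_measure_unique => //= _ [[a b]] _ <-.
rewrite /m /pushforward.
rewrite (_ : _ @^-1` _ = `](a - t)%R, (b - t)%R]%classic).
  rewrite !lebesgue_measure_itv/= !lte_fin ltrD2r.
  by rewrite -!EFinB; case: ifPn => // _; congr (_%:E); ring.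
by apply/seteqP; split=> x /=; rewrite !in_itv/= lerBrDl ltrBlDl.
Qed.

Lemma integral_haarE (F : L3 R -> \bar R) : measurable_fun setT F ->
  (forall x, 0 <= F x) ->
  \int[@haar R]_x F x =
  \int[@lebesgue_measure R]_a \int[@lebesgue_measure R]_b
    \int[@lebesgue_measure R]_c F ((a, b), c).
Proof.
move=> mF F0; rewrite /haar fubini_tonelli1//.
rewrite /lebesgue2 fubini_tonelli1//.
- exact: measurable_fun_fubini_tonelli_F.
- by move=> p; exact: integral_ge0.
Qed.

Lemma hmul_measurable d (T : measurableType d) (f g : T -> L3 R) :
  measurable_fun setT f -> measurable_fun setT g ->
  measurable_fun setT (fun x => hmul (f x) (g x) : L3 R).
Proof.
move=> mf mg.
have m1 h (mh : measurable_fun setT h) := measurableT_comp (@hfst_measurable R) (mh : measurable_fun setT (h : T -> L3 R)).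
have m2 h (mh : measurable_fun setT h) := measurableT_comp (@hsnd_measurable R) (mh : measurable_fun setT (h : T -> L3 R)).
have m3 h (mh : measurable_fun setT h) := measurableT_comp (@htrd_measurable R) (mh : measurable_fun setT (h : T -> L3 R)).
rewrite /hmul; apply/measurable_fun_pair; first apply/measurable_fun_pair.
- exact: (measurable_funD (m1 _ mf) (m1 _ mg)).
- exact: (measurable_funD (m2 _ mf) (m2 _ mg)).
- exact: (measurable_funD (measurable_funD (m3 _ mf) (m3 _ mg)) (measurable_funM (m1 _ mf) (m2 _ mg))).
Qed.

Lemma hinv_measurable : measurable_fun setT (@hinv R : L3 R -> L3 R).
Proof.
rewrite /hinv; apply/measurable_fun_pair; first apply/measurable_fun_pair.
- exact: (measurable_funN hfst_measurable).
- exact: (measurable_funN hsnd_measurable).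
- exact: (measurable_funD (measurable_funN htrd_measurable) (measurable_funM hfst_measurable hsnd_measurable)).
Qed.

Lemma haar_left_invariant (F : L3 R -> \bar R) (y : L3 R) :
  measurable_fun setT F -> (forall x, 0 <= F x) ->
  \int[@haar R]_x F (hmul y x) = \int[@haar R]_x F x.
Proof.
move=> mF F0.
have mFy : measurable_fun setT (fun x => F (hmul y x)).
  apply: (measurableT_comp mF); exact: hmul_measurable.
rewrite (integral_haarE mFy (fun x => F0 _)) (integral_haarE mF F0).
have mF2 : measurable_fun setT (fubini_F (@lebesgue_measure R) F).
  exact: measurable_fun_fubini_tonelli_F.
have F20 p : 0 <= fubini_F (@lebesgue_measure R) F p by exact: integral_ge0.
have mF1 : measurable_fun setT (fubini_F (@lebesgue_measure R) (fubini_F (@lebesgue_measure R) F)).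
  exact: measurable_fun_fubini_tonelli_F.
rewrite -[RHS](integral_shift y.1.1 mF1); last first.
  by move=> a; exact: integral_ge0.
apply: eq_integral => a _; rewrite /fubini_F/=.
rewrite -[RHS](@integral_shift y.1.2 (fun b => fubini_F (@lebesgue_measure R) F ((y.1.1 + a)%R, b)))//; last first.
  exact: (measurable_fun_pair2 _ mF2).
apply: eq_integral => b _; rewrite /fubini_F/=.
rewrite -[RHS](@integral_shift (y.2 + y.1.1 * b) (fun c => F ((y.1.1 + a)%R, (y.1.2 + b)%R, c)))//; last first.
  exact: (measurable_fun_pair2 _ mF).
by apply: eq_integral => c _; rewrite /hmul/= addrAC.
Qed.

End haar_invariance.

#[global] Instance ae_haar_filter (R : realType) :
  Filter (nbhs (almost_everywhere (@haar R))).
Proof. exact: (ae_filter_ringOfSetsType (@haar R)). Qed.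

Record weight (R : realType) := Weight {
  weight_fun :> R * R * R -> R;
  weight_continuous : continuous weight_fun;
  weight_gt0 : forall x, 0 < weight_fun x;
  weight_hmul : forall x y,
    weight_fun (hmul x y) <= weight_fun x * weight_fun y }.

Section measurable_complex.
Context d (T : measurableType d) {R : realType}.
Implicit Types f g : T -> R[i].

Definition cmeasurable f :=
  measurable_fun setT (fun x => complex.Re (f x)) /\
  measurable_fun setT (fun x => complex.Im (f x)).

Lemma cmeasurable_normc f : cmeasurable f ->
  measurable_fun setT (fun x => Normc.normc (f x)).
Proof.
move=> [mR mI].
rewrite (_ : (fun x => _) =
  fun x => Num.sqrt (complex.Re (f x) ^+ 2 + complex.Im (f x) ^+ 2)); last first.
  by apply/funext => x; case: (f x).
apply: (measurableT_comp (f := fun r : R => Num.sqrt r)).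
  apply: continuous_measurable_fun; exact: sqrt_continuous.
by apply: measurable_funD; apply: measurable_funX.
Qed.

Lemma cmeasurableD f g : cmeasurable f -> cmeasurable g -> cmeasurable (fun x => f x + g x).
Proof.
move=> [fR fI] [gR gI]; split.
  rewrite (_ : (fun x => _) = fun x => complex.Re (f x) + complex.Re (g x)).
    exact: measurable_funD.
  by apply/funext => x; case: (f x) (g x) => [? ?] [].
rewrite (_ : (fun x => _) = fun x => complex.Im (f x) + complex.Im (g x)).
  exact: measurable_funD.
by apply/funext => x; case: (f x) (g x) => [? ?] [].
Qed.

Lemma cmeasurableM f g : cmeasurable f -> cmeasurable g -> cmeasurable (fun x => f x * g x).
Proof.
move=> [fR fI] [gR gI]; split.
  rewrite (_ : (fun x => _) = fun x => complex.Re (f x) * complex.Re (g x) - complex.Im (f x) * complex.Im (g x)).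
    by apply: measurable_funB; exact: measurable_funM.
  by apply/funext => x; case: (f x) (g x) => [? ?] [].
rewrite (_ : (fun x => _) = fun x => complex.Re (f x) * complex.Im (g x) + complex.Im (f x) * complex.Re (g x)).
  by apply: measurable_funD; exact: measurable_funM.
by apply/funext => x; case: (f x) (g x) => [? ?] [].
Qed.

Lemma cmeasurable_cst (c : R[i]) : cmeasurable (fun=> c).
Proof. by split; exact: measurable_cst. Qed.

End measurable_complex.

Lemma cmeasurable_comp d d' (T : measurableType d) (T' : measurableType d')
    {R : realType} (f : T' -> R[i]) (p : T -> T') :
  cmeasurable f -> measurable_fun setT p -> cmeasurable (fun x => f (p x)).
Proof.
move=> [mR mI] mp; split.
  exact: (measurableT_comp mR mp).
exact: (measurableT_comp mI mp).
Qed.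

Section weighted_L1.
Context {R : realType} (w : weight R).
Implicit Types f g : R * R * R -> R[i].

(* the integrand |f| w of the norm of L^1(G, w) *)
Definition wabs f (x : R * R * R) : R := Normc.normc (f x) * w x.

Definition L1_set : set (R * R * R -> R[i]) :=
  [set f | @cmeasurable _ (L3 R) R f /\
           (@haar R).-integrable setT (fun x => (wabs f x)%:E)].

Lemma wabs_ge0 f x : 0 <= wabs f x.
Proof.
apply: mulr_ge0; last exact/ltW/weight_gt0.
by case: (f x) => a b /=; exact: sqrtr_ge0.
Qed.

Lemma weight_measurable : measurable_fun setT (w : L3 R -> R).
Proof. exact: (continuous_hmeasurable (@weight_continuous _ w)). Qed.

Lemma wabs_measurable f : @cmeasurable _ (L3 R) R f ->
  measurable_fun setT (wabs f : L3 R -> R).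
Proof.
by move=> mf; apply: measurable_funM; [exact: cmeasurable_normc|exact: weight_measurable].
Qed.

Lemma L1_setP f : L1_set f <->
  @cmeasurable _ (L3 R) R f /\ (\int[@haar R]_x (wabs f x)%:E < +oo)%E.
Proof.
have absE : (\int[@haar R]_x `|(wabs f x)%:E| = \int[@haar R]_x (wabs f x)%:E)%E.
  by apply: eq_integral => x _; rewrite gee0_abs// lee_fin wabs_ge0.
split=> -[mf fi]; split=> //.
  by move/integrableP: fi => [_]; rewrite absE.
apply/integrableP; split.
  by apply/measurable_EFinP; exact: wabs_measurable.
by rewrite absE.
Qed.

Definition L1_pred : {pred (R * R * R -> R[i])} := mem L1_set.

Lemma L1_submod_closed : submod_closed L1_pred.
Proof.
split.
  rewrite inE; apply/L1_setP; split; first exact: cmeasurable_cst.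
  under eq_integral do rewrite /wabs /= expr0n addr0 sqrtr0 mul0r.
  by rewrite integral0 ltry.
move=> a f g /[!inE] [[mf fi] [mg gi]]; apply/L1_setP; split.
  apply: cmeasurableD => //.
  by apply: cmeasurableM => //; exact: cmeasurable_cst.
pose h x := ((Normc.normc a)%:E * (wabs f x)%:E + (wabs g x)%:E)%E.
have hi : (@haar R).-integrable setT h.
  by apply: integrableD => //; apply: integrableZl.
apply: (@le_lt_trans _ _ (\int[@haar R]_x h x)%E); last first.
  by have := integrable_fin_num measurableT hi; rewrite ge0_fin_numE// integral_ge0// => x _;
     rewrite /h -EFinM -EFinD lee_fin addr_ge0 ?wabs_ge0// mulr_ge0 ?wabs_ge0//; case: (a) => ? ?; exact: sqrtr_ge0.
apply: ge0_le_integral => //.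
- by move=> x _; rewrite lee_fin wabs_ge0.
- apply/measurable_EFinP; apply: wabs_measurable; apply: cmeasurableD => //.
  by apply: cmeasurableM => //; exact: cmeasurable_cst.
- exact: measurable_int hi.
- move=> x _; rewrite /h -EFinM -EFinD lee_fin /wabs mulrA -Normc.normcM -mulrDl.
  by rewrite ler_pM2r ?weight_gt0//; exact: le_normcD.
Qed.

HB.instance Definition _ := GRing.isSubmodClosed.Build R[i] (R * R * R -> R[i])
  L1_pred L1_submod_closed.

Record L1fun := { L1fun_val :> R * R * R -> R[i]; L1funP : L1fun_val \in L1_pred }.
HB.instance Definition _ := [isSub for L1fun_val].
HB.instance Definition _ := [Choice of L1fun by <:].
HB.instance Definition _ := [SubChoice_isSubLmodule of L1fun by <:].

(* [L1] is the quotient by almost everywhere equality. *)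
Definition L1null : {pred L1fun} :=
  mem [set f : L1fun | \forall x \ae @haar R, f x = 0].

Lemma L1null_zmod_closed : zmod_closed L1null.
Proof.
split; first by rewrite inE; exact: nearW.
move=> f g /[!inE] /= f0 g0; apply: filterS2 f0 g0 => x fx gx.
change (f x - g x = 0).
by rewrite fx gx subr0.
Qed.
HB.instance Definition _ := GRing.isZmodClosed.Build L1fun L1null L1null_zmod_closed.

Definition L1 : Type := Quotient.quot L1null.
HB.instance Definition _ := GRing.Zmodule.on L1.
HB.instance Definition _ := EqQuotient.on L1.

Local Open Scope quotient_scope.

Lemma L1_eqP (f g : L1fun) :
  \pi_L1 f = \pi_L1 g <-> \forall x \ae @haar R, f x = g x.
Proof.
split=> [/eqP|fg].
  rewrite -Quotient.idealrBE inE /=; apply: filterS => x.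
  by move=> fg; apply/eqP; rewrite -subr_eq0; apply/eqP.
apply/eqP; rewrite -Quotient.idealrBE inE /=; apply: filterS fg => x fg.
by change (f x - g x = 0); rewrite fg subrr.
Qed.

Lemma repr_L1 (f : L1fun) : \forall x \ae @haar R, repr (\pi_L1 f) x = f x.
Proof. by apply/L1_eqP; rewrite reprK. Qed.

Lemma L1_piD (f g : L1fun) : \pi_L1 (f + g) = \pi_L1 f + \pi_L1 g.
Proof. exact: (Quotient.pi_add L1null). Qed.

Lemma L1_pi0 : \pi_L1 (0 : L1fun) = 0.
Proof. by apply: (addrI (\pi_L1 (0 : L1fun))); rewrite -L1_piD !addr0. Qed.

Definition L1_scale (a : R[i]) (u : L1) : L1 := \pi_L1 (a *: repr u).

Lemma L1_piZ a (f : L1fun) : \pi_L1 (a *: f) = L1_scale a (\pi_L1 f).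
Proof.
apply/esym/L1_eqP; apply: filterS (repr_L1 f) => x fx.
by change (a * repr (\pi_L1 f) x = a * f x); rewrite fx.
Qed.

Let scaleA a b u : L1_scale a (L1_scale b u) = L1_scale (a * b) u.
Proof.
rewrite -[u]reprK; move: (repr u) => {}u.
by rewrite -[L1_scale b _]L1_piZ -!L1_piZ scalerA.
Qed.
Let scale1 : left_id 1 L1_scale.
Proof. by move=> u; rewrite -[in LHS](reprK u) -L1_piZ scale1r reprK. Qed.
Let scaleDr : right_distributive L1_scale +%R.
Proof. by move=> a u v; rewrite -(reprK u) -(reprK v) -L1_piD -!L1_piZ -L1_piD scalerDr. Qed.
Let scaleDl u : {morph L1_scale^~ u : a b / a + b}.
Proof. by move=> a b; rewrite -(reprK u) -!L1_piZ -L1_piD scalerDl. Qed.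
HB.instance Definition _ := GRing.Zmodule_isLmodule.Build R[i] L1 scaleA scale1 scaleDr scaleDl.

Definition wnorm f : R := \int[@haar R]_x wabs f x.

Lemma L1fun_cmeasurable (f : L1fun) : @cmeasurable _ (L3 R) R f.
Proof. by have := L1funP f; rewrite inE => -[]. Qed.

Lemma L1fun_integrable (f : L1fun) :
  (@haar R).-integrable setT (fun x => (wabs f x)%:E).
Proof. by have := L1funP f; rewrite inE => -[]. Qed.

Lemma wnormE (f : L1fun) : (wnorm f)%:E = (\int[@haar R]_x (wabs f x)%:E)%E.
Proof.
by rewrite fineK//; apply: integrable_fin_num => //; exact: L1fun_integrable.
Qed.

Lemma wnorm_ae (f g : L1fun) : (\forall x \ae @haar R, f x = g x) -> wnorm f = wnorm g.
Proof.
move=> fg; apply: EFin_inj; rewrite !wnormE.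
apply: ae_eq_integral => //.
- by apply/measurable_EFinP; apply: wabs_measurable; exact: L1fun_cmeasurable.
- by apply/measurable_EFinP; apply: wabs_measurable; exact: L1fun_cmeasurable.
- by apply: filterS fg => x fg _; rewrite /wabs fg.
Qed.

Lemma wnorm_eq0 (f : L1fun) : wnorm f = 0 -> \forall x \ae @haar R, f x = 0.
Proof.
move=> f0.
have mf : measurable_fun setT (fun x : L3 R => (wabs f x)%:E).
  by apply/measurable_EFinP; apply: wabs_measurable; exact: L1fun_cmeasurable.
have : (\int[@haar R]_x `|(wabs f x)%:E| = 0)%E.
  rewrite -[RHS]/(0%:E) -f0 wnormE.
  by apply: eq_integral => x _; rewrite gee0_abs// lee_fin wabs_ge0.
move/(ae_eq_integral_abs _ measurableT mf); apply: filterS => x /(_ I) [] /eqP.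
by rewrite mulf_eq0 (gt_eqF (weight_gt0 w x)) orbF => /eqP /Normc.eq0_normc.
Qed.

Lemma wnormD (f g : L1fun) : wnorm (f + g : L1fun) <= wnorm f + wnorm g.
Proof.
rewrite -lee_fin EFinD !wnormE -integralD//; try exact: L1fun_integrable.
apply: ge0_le_integral => //.
- by move=> x _; rewrite lee_fin wabs_ge0.
- exact: measurable_int (L1fun_integrable _).
- by apply: emeasurable_funD; exact: measurable_int (L1fun_integrable _).
- move=> x _; rewrite -EFinD lee_fin /wabs -mulrDl ler_pM2r ?weight_gt0//.
  exact: le_normcD.
Qed.

Lemma wnormZ a (f : L1fun) : wnorm (a *: f : L1fun) = Normc.normc a * wnorm f.
Proof.
apply: EFin_inj; rewrite EFinM !wnormE -integralZl//; last exact: L1fun_integrable.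
by apply: eq_integral => x _; rewrite -EFinM /wabs mulrA -Normc.normcM.
Qed.

Definition L1_norm (u : L1) : R[i] := (wnorm (repr u))%:C%C.

Lemma L1_norm_pi (f : L1fun) : L1_norm (\pi_L1 f) = (wnorm f)%:C%C.
Proof. by rewrite /L1_norm (wnorm_ae (repr_L1 f)). Qed.

Let normD u v : L1_norm (u + v) <= L1_norm u + L1_norm v.
Proof.
rewrite -(reprK u) -(reprK v) -L1_piD !L1_norm_pi -rmorphD/= lecR.
exact: wnormD.
Qed.
Let normZ a u : L1_norm (a *: u) = `|a| * L1_norm u.
Proof.
rewrite -(reprK u) -[a *: _]L1_piZ !L1_norm_pi wnormZ rmorphM/=.
by congr (_ * _); rewrite normc_def; case: a.
Qed.
Let norm0_eq0 u : L1_norm u = 0 -> u = 0.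
Proof.
rewrite -(reprK u) L1_norm_pi => -[] /wnorm_eq0 u0.
transitivity (\pi_L1 (0 : L1fun)); last exact: L1_pi0.
exact/L1_eqP.
Qed.
HB.instance Definition _ := Lmodule_isNormed.Build R[i] L1 normD normZ norm0_eq0.

End weighted_L1.

Section convolution.
Context {R : realType}.

Definition haar_integral (h : R * R * R -> R[i]) : R[i] :=
  Complex (\int[@haar R]_x complex.Re (h x)) (\int[@haar R]_x complex.Im (h x)).

(* Where the integrand is not integrable (a null set of x when f and g are in
   L^1(G, w)) the value is a default one. *)
Definition conv (f g : R * R * R -> R[i]) (x : R * R * R) : R[i] :=
  haar_integral (fun y => f y * g (hmul (hinv y) x)).

Let measurable_param (phi : L3 R * L3 R -> R) : measurable_fun setT phi ->
  measurable_fun setT (fun x => \int[@haar R]_y phi (x, y)).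
Proof.
move=> mphi; apply: (measurableT_comp (fine_measurable measurableT)).
rewrite (_ : (fun x => _) = fun x =>
  (fubini_F (@haar R) (EFin \o phi)^\+ x - fubini_F (@haar R) (EFin \o phi)^\- x)%E).
  have mE : measurable_fun setT (EFin \o phi) by exact/measurable_EFinP.
  apply: emeasurable_funB; apply: measurable_fun_fubini_tonelli_F => //.
    exact: measurable_funepos.
  exact: measurable_funeneg.
by apply/funext => x; rewrite integralE /fubini_F; congr (_ - _)%E; apply: eq_integral => y _; rewrite ?funeposE ?funenegE.
Qed.

Let normc_le (a b : R) : Normc.normc (Complex a b) <= `|a| + `|b|.
Proof.
rewrite /= -[leRHS]ger0_norm ?addr_ge0// -sqrtr_sqr ler_wsqrtr// sqrrD.
by rewrite !real_normK ?num_real// lerD2r lerDl mulrn_wge0// mulr_ge0.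
Qed.

Let Re_le (z : R[i]) : `|complex.Re z| <= Normc.normc z.
Proof.
case: z => a b /=; rewrite -sqrtr_sqr ler_wsqrtr// lerDl; exact: sqr_ge0.
Qed.

Let Im_le (z : R[i]) : `|complex.Im z| <= Normc.normc z.
Proof.
case: z => a b /=; rewrite -sqrtr_sqr ler_wsqrtr// lerDr; exact: sqr_ge0.
Qed.

Let Rintegral_le (h : L3 R -> R) (k : L3 R -> R) :
  measurable_fun setT h -> measurable_fun setT k ->
  (forall x, `|h x| <= k x) ->
  ((`|\int[@haar R]_x h x|)%:E <= \int[@haar R]_x (k x)%:E)%E.
Proof.
move=> mh mk hk; apply: (@le_trans _ _ `|\int[@haar R]_x (h x)%:E|%E).
  by rewrite /Rintegral; case: (integral _ _ _) => //=; rewrite normr0 leey.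
apply: (@le_trans _ _ (\int[@haar R]_x `|(h x)%:E|)%E).
  apply: le_abse_integral => //; exact/measurable_EFinP.
apply: ge0_le_integral => //.
- by apply: measurableT_comp => //; exact/measurable_EFinP.
- exact/measurable_EFinP.
- by move=> x _; rewrite lee_fin.
Qed.

Context (w : weight R).

Lemma conv_L1 (f g : L1fun w) : conv f g \in L1_pred w.
Proof.
pose q (z : L3 R * L3 R) : L3 R := hmul (hinv z.2) z.1.
have mq : measurable_fun setT q.
  apply: hmul_measurable; last exact: measurable_fst.
  apply: (measurableT_comp hinv_measurable); exact: measurable_snd.
pose K (z : L3 R * L3 R) := f z.2 * g (q z).
have mK : cmeasurable K.
  apply: cmeasurableM.
    by apply: cmeasurable_comp; [exact: L1fun_cmeasurable|exact: measurable_snd].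
  by apply: cmeasurable_comp => //; exact: L1fun_cmeasurable.
have [mKR mKI] := mK.
have mc : @cmeasurable _ (L3 R) R (conv f g).
  split.
    exact: (measurable_param mKR).
  exact: (measurable_param mKI).
rewrite inE; apply/L1_setP; split => //.
pose H (z : L3 R * L3 R) := ((wabs w f z.2)%:E * (wabs w g (q z))%:E)%E.
have mH : measurable_fun setT H.
  apply: emeasurable_funM; apply/measurable_EFinP.
    apply: (measurableT_comp (wabs_measurable w (L1fun_cmeasurable f))).
    exact: measurable_snd.
  exact: (measurableT_comp (wabs_measurable w (L1fun_cmeasurable g)) mq).
have H0 z : (0 <= H z)%E by rewrite mule_ge0 ?lee_fin ?wabs_ge0.
have mHF : measurable_fun setT (fubini_F (@haar R) H).
  exact: measurable_fun_fubini_tonelli_F.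
apply: (@le_lt_trans _ _ (2%:E * \int[@haar R]_x fubini_F (@haar R) H x)%E).
  rewrite -ge0_integralZl//; last first.
    by move=> x _; exact: integral_ge0.
  apply: ge0_le_integral => //.
  - by move=> x _; rewrite lee_fin wabs_ge0.
  - by apply/measurable_EFinP; exact: wabs_measurable.
  - exact: measurable_funeM.
  move=> x _.
  have mKx : @cmeasurable _ (L3 R) R (fun y => K (x, y)).
    by split; [exact: (measurable_fun_pair2 _ mKR)|exact: (measurable_fun_pair2 _ mKI)].
  have mnKx := cmeasurable_normc mKx.
  have [mKxR mKxI] := mKx.
  pose M := (\int[@haar R]_y (Normc.normc (K (x, y)))%:E)%E.
  have M0 : (0 <= M)%E.
    by apply: integral_ge0 => y _; rewrite lee_fin (le_trans _ (Re_le _)).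
  apply: (@le_trans _ _ (2%:E * ((w x)%:E * M))%E); last first.
    rewrite lee_pmul2l// /M -ge0_integralZl//; first last.
    - by rewrite lee_fin ltW// weight_gt0.
    - by move=> y _; rewrite lee_fin (le_trans _ (Re_le _)).
    - exact/measurable_EFinP.
    apply: ge0_le_integral => //.
    - by move=> y _; rewrite -EFinM lee_fin mulr_ge0 ?(le_trans _ (Re_le _))// ltW// weight_gt0.
    - by apply: measurable_funeM; exact/measurable_EFinP.
    - exact: (measurable_fun_pair2 _ mH).
    - move=> y _; rewrite /H/= -!EFinM lee_fin /K /wabs /= Normc.normcM.
      rewrite [leRHS](_ : _ = (w y * w (q (x, y))) * (Normc.normc (f y) * Normc.normc (g (q (x, y))))); last by ring.
      rewrite ler_wpM2r ?mulr_ge0 ?(le_trans _ (Re_le _))//.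
      rewrite -[in leLHS](_ : hmul y (q (x, y)) = x); first exact: weight_hmul.
      by rewrite /q /= hmulA hmulxV hmul1.
  rewrite muleCA /wabs mulrC EFinM lee_pmul2l ?lte_fin ?weight_gt0//.
  rewrite (_ : 2%:E = 1%:E + 1%:E)%E; last by rewrite -EFinD.
  rewrite ge0_muleDl// !mul1e.
  apply: (@le_trans _ _ (`|complex.Re (conv f g x)| + `|complex.Im (conv f g x)|)%:E).
    by rewrite lee_fin; case: (conv f g x) => a b; exact: normc_le.
  rewrite EFinD; apply: leeD.
    exact: Rintegral_le.
  exact: Rintegral_le.
rewrite -fubini_tonelli1// fubini_tonelli2//.
have inv y : (\int[@haar R]_x (wabs w g (hmul (hinv y) x))%:E = (wnorm w g)%:E)%E.
  rewrite wnormE; apply: (@haar_left_invariant _ (fun x => (wabs w g x)%:E)).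
    apply/measurable_EFinP; exact: wabs_measurable (L1fun_cmeasurable g).
  by move=> x; rewrite lee_fin wabs_ge0.
rewrite (_ : integral _ _ _ =
    (\int[@haar R]_y ((wabs w f y)%:E * (wnorm w g)%:E))%E); last first.
  apply: eq_integral => y _; rewrite /fubini_G /H /=.
  rewrite ge0_integralZl//; first by rewrite inv.
  - apply/measurable_EFinP; apply: (measurableT_comp (wabs_measurable w (L1fun_cmeasurable g))).
    exact: (measurable_fun_pair1 _ mq).
  - by move=> x _; rewrite lee_fin wabs_ge0.
  - by rewrite lee_fin wabs_ge0.
rewrite ge0_integralZr//; first last.
- by rewrite lee_fin; apply: Rintegral_ge0 => x _; exact: wabs_ge0.
- by move=> y _; rewrite lee_fin wabs_ge0.
- apply/measurable_EFinP; exact: wabs_measurable (L1fun_cmeasurable f).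
by rewrite -wnormE -!EFinM ltry.
Qed.

Definition L1_conv_fun (f g : L1fun w) : L1fun w := Build_L1fun (conv_L1 f g).

Local Open Scope quotient_scope.

(* Independent of the representatives, see [L1_mul_pi]. *)
Definition L1_mul (u v : L1 w) : L1 w := \pi_(L1 w) (L1_conv_fun (repr u) (repr v)).

End convolution.

Section convolution_ae.
Context {R : realType} (w : weight R).
Local Open Scope quotient_scope.

Let ae_integral0 (h : L3 R -> \bar R) : measurable_fun setT h ->
  (forall x, (0 <= h x)%E) -> (\int[@haar R]_x h x = 0)%E ->
  \forall x \ae @haar R, h x = 0%E.
Proof.
move=> mh h0 ih.
have : (\int[@haar R]_x `|h x| = 0)%E.
  by rewrite -[RHS]ih; apply: eq_integral => x _; rewrite gee0_abs.
by move/(ae_eq_integral_abs _ measurableT mh); apply: filterS => x /(_ I).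
Qed.

Let ae_translate (P : L3 R -> Prop) : (\forall x \ae @haar R, P x) ->
  \forall x \ae @haar R, \forall y \ae @haar R, P (hmul (hinv y) x).
Proof.
move=> [N [mN N0 PN]].
pose q (z : L3 R * L3 R) : L3 R := hmul (hinv z.2) z.1.
have mq : measurable_fun setT q.
  apply: hmul_measurable; last exact: measurable_fst.
  apply: (measurableT_comp hinv_measurable); exact: measurable_snd.
pose i (x : L3 R) : \bar R := (\1_N x : R)%:E.
have mi : measurable_fun setT i by exact/measurable_EFinP/measurable_indic.
have i0 x : (0 <= i x)%E by rewrite lee_fin.
have miq : measurable_fun setT (i \o q) by exact: (measurableT_comp mi mq).
have F0 : (\int[@haar R]_x fubini_F (@haar R) (i \o q) x = 0)%E.
  rewrite -fubini_tonelli1//; last by move=> z; exact: i0.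
  rewrite fubini_tonelli2//; last by move=> z; exact: i0.
  rewrite -[RHS](integral0 (@haar R) setT).
  apply: eq_integral => y _; rewrite /fubini_G /= /q /=.
  by rewrite haar_left_invariant// /i integral_indic// setIT.
have mF := measurable_fun_fubini_tonelli_F (m2 := @haar R) (i \o q) miq (fun z => i0 _).
have /(ae_integral0 mF) := F0.
case=> [x|]; first by apply: integral_ge0 => y _; exact: i0.
move=> N' [mN' N'0 PN']; exists N'; split => // x nPx; apply: PN' => /= ix; apply: nPx.
have /= := ae_integral0 (measurable_fun_pair2 x miq) (fun y => i0 _) ix.
apply: filterS => y /=; rewrite /i /q/= => -[] /eqP.
rewrite indicE pnatr_eq0 eqb0 => /negP qN.
by apply: contrapT => nP; apply: qN; rewrite inE; exact: PN.
Qed.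

Lemma L1_mul_pi (f g : L1fun w) :
  L1_mul (\pi_(L1 w) f) (\pi_(L1 w) g) = \pi_(L1 w) (L1_conv_fun f g).
Proof.
rewrite /L1_mul; apply/L1_eqP.
have mK f' g' x : @cmeasurable _ (L3 R) R (fun y => (f' : L1fun w) y * (g' : L1fun w) (hmul (hinv y) x)).
  apply: cmeasurableM; first exact: L1fun_cmeasurable.
  apply: cmeasurable_comp; first exact: L1fun_cmeasurable.
  by apply: hmul_measurable => //; exact: hinv_measurable.
have := ae_translate (repr_L1 g); apply: filterS => x gx.
have fgx : \forall y \ae @haar R, repr (\pi_(L1 w) f) y * repr (\pi_(L1 w) g) (hmul (hinv y) x) =
    f y * g (hmul (hinv y) x).
  by apply: filterS2 (repr_L1 f) gx => y -> ->.
rewrite /= /conv /haar_integral; congr Complex; congr fine; apply: ae_eq_integral => //.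
- apply/measurable_EFinP.
  exact: (mK (repr (\pi_(L1 w) f)) (repr (\pi_(L1 w) g)) x).1.
- by apply/measurable_EFinP; exact: (mK f g x).1.
- by apply: filterS fgx => y -> _.
- apply/measurable_EFinP.
  exact: (mK (repr (\pi_(L1 w) f)) (repr (\pi_(L1 w) g)) x).2.
- by apply/measurable_EFinP; exact: (mK f g x).2.
- by apply: filterS fgx => y -> _.
Qed.

End convolution_ae.

(* Main.v *)
Require Import Defs.
From HB Require Import structures.
From mathcomp Require Import all_boot all_order all_algebra complex.
From mathcomp Require Import all_classical all_reals all_analysis.
From mathcomp Require Import measurable_realfun ring lra.
Set Implicit Arguments.
Unset Strict Implicit.
Unset Printing Implicit Defensive.
Import Order.TTheory GRing.Theory Num.Theory numFieldNormedType.Exports.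
Local Open Scope classical_set_scope.
Local Open Scope ring_scope.

(* The proof. The weight w does not depend on the central coordinate and is even
   in the other two. Let F(t) be the least value of ln w(x, y, 0) over x, y >= 0
   with |t| <= x + y. Then F tends to infinity, and by submultiplicativity of w
   it varies by at most ln w(a, b, c) when its argument moves by at most
   |a| + |b|. Put phi(u, v, t) = F(t) if |u|, |v| <= 1, and 0 otherwise. As phi
   is not bounded by w, it is no functional on L^1(G_H, w); but its coboundary
   d(g, x) = phi(xg) - phi(gx) satisfies |d(g, x)| <= w(g) w(x), because xg and
   gx have the same first two coordinates, and third coordinates at distance at
   most |g_1| + |g_2| when phi does not vanish there. Hence
   D(f)(h) = \iint f(g) h(x) d(g, x) dg dx is a continuous derivation.
   If D were the inner derivation of psi, then
   D(1_A)(1_B) = psi(1_B * 1_A) - psi(1_A * 1_B) would be O(|A| |B|), uniformly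
   over all A, B such that BA stays in the region |u|, |v| <= 1, where w is
   bounded. Suitable boxes A, B far out in the direction of v make the third
   coordinate of xg arbitrarily large while that of gx stays in [-2, 2], so that
   D(1_A)(1_B) / (|A| |B|) is unbounded. *)

Local Notation L3 R :=
  (measurableTypeR R * measurableTypeR R * measurableTypeR R)%type.

(** * The complex modulus against real and imaginary parts *)

Section complex_modulus.
Context {R : realType}.
Implicit Types z : R[i].

Lemma normc_ge0 z : 0 <= Normc.normc z.
Proof. by case: z => a b; exact: sqrtr_ge0. Qed.

Lemma normr_Re_le z : `|complex.Re z| <= Normc.normc z.
Proof. by case: z => a b /=; rewrite -sqrtr_sqr ler_wsqrtr// lerDl sqr_ge0. Qed.

Lemma normr_Im_le z : `|complex.Im z| <= Normc.normc z.
Proof. by case: z => a b /=; rewrite -sqrtr_sqr ler_wsqrtr// lerDr sqr_ge0. Qed.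

Lemma normc_le_ReIm z : Normc.normc z <= `|complex.Re z| + `|complex.Im z|.
Proof.
case: z => a b /=; rewrite -[leRHS]ger0_norm ?addr_ge0// -sqrtr_sqr.
rewrite ler_wsqrtr// sqrrD !real_normK ?num_real//.
by rewrite lerD2r lerDl mulrn_wge0// mulr_ge0.
Qed.

Lemma normc_real (r : R) : Normc.normc r%:C%C = `|r|.
Proof. by rewrite /= expr0n addr0 sqrtr_sqr. Qed.

Lemma normr_normc z : `|z| = (Normc.normc z)%:C%C.
Proof. by rewrite normc_def; case: z. Qed.

End complex_modulus.

(** * Integrals of complex functions over the group *)

Section complex_integral.
Context {R : realType}.
Implicit Types h k : L3 R -> R[i].
Local Notation haarR := (@haar R).

Definition cintegrable h :=
  haarR.-integrable setT (fun x => (complex.Re (h x))%:E) /\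
  haarR.-integrable setT (fun x => (complex.Im (h x))%:E).

Lemma cintegrable_cmeasurable h : cintegrable h -> cmeasurable h.
Proof.
move=> [hR hI]; split; apply/measurable_EFinP.
- exact: measurable_int hR.
- exact: measurable_int hI.
Qed.

Lemma le_cintegrable h (b : L3 R -> R) : cmeasurable h ->
  haarR.-integrable setT (EFin \o b) -> (forall x, Normc.normc (h x) <= b x) ->
  cintegrable h.
Proof.
move=> [mR mI] ib hb; split; apply: le_integrable ib => //;
  try exact/measurable_EFinP.
- move=> x _; rewrite /= lee_fin (le_trans (normr_Re_le _))//.
  exact: le_trans (hb x) (ler_norm _).
- move=> x _; rewrite /= lee_fin (le_trans (normr_Im_le _))//.
  exact: le_trans (hb x) (ler_norm _).
Qed.

Lemma haar_integralD h k : cintegrable h -> cintegrable k ->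
  haar_integral (fun x => h x + k x) = haar_integral h + haar_integral k.
Proof.
move=> [hR hI] [kR kI]; rewrite /haar_integral /=.
apply/eqP; rewrite eq_complex /= -!RintegralD//; apply/andP; split; apply/eqP.
- by apply: eq_Rintegral => x _; case: (h x) (k x) => [? ?] [].
- by apply: eq_Rintegral => x _; case: (h x) (k x) => [? ?] [].
Qed.

Let integrableZ (r : R) (f : L3 R -> R) :
  haarR.-integrable setT (EFin \o f) ->
  haarR.-integrable setT (EFin \o (fun x => r * f x)).
Proof.
move=> fi.
rewrite (_ : _ \o _ = (fun x => r%:E * (EFin \o f) x)%E); first exact: integrableZl.
by apply/funext => x; rewrite /= EFinM.
Qed.

Lemma haar_integralZl (c : R[i]) h : cintegrable h ->
  haar_integral (fun x => c * h x) = c * haar_integral h.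
Proof.
case: c => a b [hR hI]; rewrite /haar_integral.
apply/eqP; rewrite eq_complex /= -!RintegralZl// -RintegralB ?integrableZ//.
rewrite -RintegralD ?integrableZ//.
apply/andP; split; apply/eqP.
- by apply: eq_Rintegral => x _; case: (h x).
- by apply: eq_Rintegral => x _; case: (h x).
Qed.

Lemma cintegrableZl (c : R[i]) h : cintegrable h ->
  cintegrable (fun x => c * h x).
Proof.
case: c => a b [hR hI]; split.
- rewrite (_ : (fun x => _) = ((EFin \o (fun x => a * complex.Re (h x))%R) \-
    (EFin \o (fun x => b * complex.Im (h x))%R))%E).
    by apply: integrableB => //; exact: integrableZ.
  by apply/funext => x /=; case: (h x) => u v /=; rewrite EFinB.
- rewrite (_ : (fun x => _) = ((EFin \o (fun x => a * complex.Im (h x))%R) \+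
    (EFin \o (fun x => b * complex.Re (h x))%R))%E).
    by apply: integrableD => //; exact: integrableZ.
  by apply/funext => x /=; case: (h x) => u v /=; rewrite EFinD.
Qed.

(** The factor 2 comes from bounding the integrals of the real and of the imaginary part separately
    by that of [b]. *)
Lemma haar_integral_le h (b : L3 R -> R) : cmeasurable h ->
  haarR.-integrable setT (EFin \o b) -> (forall x, Normc.normc (h x) <= b x) ->
  Normc.normc (haar_integral h) <= 2 * \int[haarR]_x b x.
Proof.
move=> mh ib hb; have [hR hI] := le_cintegrable mh ib hb.
have bound (f : L3 R -> R) : haarR.-integrable setT (EFin \o f) ->
    (forall x, `|f x| <= b x) -> `|\int[haarR]_x f x| <= \int[haarR]_x b x.
  move=> fi fb; apply: (le_trans (le_normr_Rintegral _ _)) => //.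
  apply: le_Rintegral => //; exact: (integrable_abse fi).
apply: (le_trans (normc_le_ReIm _)); rewrite mulr2n mulrDl mul1r.
by apply: lerD; apply: bound => // x; apply: le_trans (hb x);
  [exact: normr_Re_le|exact: normr_Im_le].
Qed.

Lemma ae_eq_haar_integral h k : cmeasurable h -> cmeasurable k ->
  (\forall x \ae haarR, h x = k x) -> haar_integral h = haar_integral k.
Proof.
move=> [hR hI] [kR kI] hk; rewrite /haar_integral.
congr Complex; congr fine; apply: ae_eq_integral => //;
  try exact/measurable_EFinP; by apply: filterS hk => x ->.
Qed.

Lemma eq_haar_integral h k : h =1 k -> haar_integral h = haar_integral k.
Proof. by move=> /funext ->. Qed.

(** Left invariance is available for nonnegative integrands, so it is applied to the positive and
    negative parts of the real and imaginary parts. *)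
Lemma haar_integral_shift h (y : L3 R) : cintegrable h ->
  haar_integral (fun x => h (hmul y x)) = haar_integral h.
Proof.
move=> /cintegrable_cmeasurable[mR mI].
have real (f : L3 R -> R) : measurable_fun setT f ->
    (\int[haarR]_x (f (hmul y x))%:E = \int[haarR]_x (f x)%:E)%E.
  move=> mf; rewrite integralE [RHS]integralE.
  have mE : measurable_fun setT (EFin \o f) by exact/measurable_EFinP.
  congr (_ - _)%E.
  - rewrite -[RHS](haar_left_invariant y (measurable_funepos mE))//.
    by apply: eq_integral => x _; rewrite !funeposE.
  - rewrite -[RHS](haar_left_invariant y (measurable_funeneg mE))//.
    by apply: eq_integral => x _; rewrite !funenegE.
rewrite /haar_integral; congr Complex; congr fine.
- exact: (real (fun x => complex.Re (h x))).
- exact: (real (fun x => complex.Im (h x))).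
Qed.

End complex_integral.

(** * Measurability in a parameter and Fubini's theorem for complex functions *)

Section complex_fubini.
Context {R : realType}.
Local Notation haarR := (@haar R).

(** Tonelli handles the positive and negative parts, and [fine] of their difference stays
    measurable; this covers the parameters at which the integral takes a default value. *)
Lemma cmeasurable_haar_integral d (T : measurableType d)
    (K : T * L3 R -> R[i]) : cmeasurable K ->
  cmeasurable (fun x => haar_integral (fun y => K (x, y))).
Proof.
have real (f : T * L3 R -> R) : measurable_fun setT f ->
    measurable_fun setT (fun x => \int[haarR]_y f (x, y)).
  move=> mf; apply: (measurableT_comp (fine_measurable measurableT)).
  have mE : measurable_fun setT (EFin \o f) by exact/measurable_EFinP.
  rewrite (_ : (fun x => _) = fun x => (fubini_F haarR (EFin \o f)^\+ x -
      fubini_F haarR (EFin \o f)^\- x)%E); last first.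
    apply/funext => x; rewrite integralE /fubini_F; congr (_ - _)%E;
      by apply: eq_integral => y _; rewrite ?funeposE ?funenegE.
  apply: emeasurable_funB; apply: measurable_fun_fubini_tonelli_F => //.
    exact: measurable_funepos.
  exact: measurable_funeneg.
by move=> [mR mI]; split; [exact: (real _ mR)|exact: (real _ mI)].
Qed.

Let pint (f : L3 R * L3 R -> \bar R) := (haarR \x haarR)%E.-integrable setT f.

(** An integrable function is finite almost everywhere, so [fine] alters it on a null set only. *)
Let integral_fine (f : L3 R -> \bar R) : haarR.-integrable setT f ->
  (\int[haarR]_x (fine (f x))%:E = \int[haarR]_x f x)%E.
Proof.
move=> fi; have mf := measurable_int _ fi.
apply: ae_eq_integral => //.
  by apply/measurable_EFinP; exact: (measurableT_comp (fine_measurable measurableT)).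
by apply: filterS (integrable_ae measurableT fi) => x fx _; rewrite fineK// fx.
Qed.

Let Rintegral_Fubini (f : L3 R * L3 R -> R) : pint (EFin \o f) ->
  \int[haarR]_x \int[haarR]_y f (x, y) = \int[haarR]_y \int[haarR]_x f (x, y).
Proof.
move=> fi; have mf := measurable_int _ fi.
(* [Rintegral] puts a [fine] around each inner integral. Removing it in both orders requires
   integrability of the kernel with exchanged arguments as well. *)
have fi' : pint (EFin \o f \o (fun z => (z.2, z.1))).
  apply/integrable12ltyP; last exact: (integrable21ltyP _ _ mf).1 fi.
  by apply: (measurableT_comp mf); exact: measurable_fun_pair.
rewrite /Rintegral; congr fine.
rewrite (integral_fine (integrable_fubini_F fi)).
rewrite (integral_fine (integrable_fubini_F fi')).
exact: (Fubini fi).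
Qed.

Section dominated.
Variables (K : L3 R * L3 R -> R[i]) (H : L3 R * L3 R -> R).
Hypotheses (mK : cmeasurable K) (iH : (haarR \x haarR)%E.-integrable setT (EFin \o H)).
Hypothesis KH : forall z, Normc.normc (K z) <= H z.

Let iRe : pint (EFin \o (fun z => complex.Re (K z))).
Proof.
apply: le_integrable iH => //; first by apply/measurable_EFinP; exact: mK.1.
move=> z _; rewrite /= lee_fin (le_trans (normr_Re_le _))//.
exact: le_trans (KH z) (ler_norm _).
Qed.

Let iIm : pint (EFin \o (fun z => complex.Im (K z))).
Proof.
apply: le_integrable iH => //; first by apply/measurable_EFinP; exact: mK.2.
move=> z _; rewrite /= lee_fin (le_trans (normr_Im_le _))//.
exact: le_trans (KH z) (ler_norm _).
Qed.

Lemma ae_cintegrable :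
  \forall x \ae haarR, cintegrable (fun y => K (x, y)).
Proof. by apply: filterS2 (ae_integrable1 iRe) (ae_integrable1 iIm) => x ? ?; split. Qed.

Lemma haar_integral_Fubini :
  haar_integral (fun x => haar_integral (fun y => K (x, y))) =
  haar_integral (fun y => haar_integral (fun x => K (x, y))).
Proof.
rewrite /haar_integral /=; congr Complex.
- exact: (Rintegral_Fubini iRe).
- exact: (Rintegral_Fubini iIm).
Qed.

End dominated.

Lemma integrable_prod (a b : L3 R -> R) :
  haarR.-integrable setT (EFin \o a) -> haarR.-integrable setT (EFin \o b) ->
  (haarR \x haarR)%E.-integrable setT (fun z => (a z.1 * b z.2)%:E).
Proof.
move=> ia ib.
have ma : measurable_fun setT a by apply/measurable_EFinP; exact: measurable_int ia.
have mb : measurable_fun setT b by apply/measurable_EFinP; exact: measurable_int ib.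
apply/integrable12ltyP.
  apply/measurable_EFinP; apply: measurable_funM.
  - exact: (measurableT_comp ma measurable_fst).
  - exact: (measurableT_comp mb measurable_snd).
have iab : (\int[haarR]_y `|(b y)%:E| < +oo)%E by case/integrableP : ib.
rewrite (_ : (\int[haarR]_x _)%E =
    (\int[haarR]_x (`|(a x)%:E| * \int[haarR]_y `|(b y)%:E|))%E); last first.
  apply: eq_integral => x _; rewrite -ge0_integralZl//.
    by apply: eq_integral => y _; rewrite EFinM abseM.
  by apply: measurableT_comp => //; exact/measurable_EFinP.
rewrite ge0_integralZr//; last 2 first.
- by apply: measurableT_comp => //; exact/measurable_EFinP.
- exact: integral_ge0.
apply: lte_mul_pinfty => //; first exact: integral_ge0.
by rewrite ge0_fin_numE; [case/integrableP : ia|exact: integral_ge0].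
Qed.

End complex_fubini.

(** * Pairing of L^1(G, w) with functions dominated by w *)

Section convolution_pairing.
Context {R : realType} (w : weight R).
Local Notation haarR := (@haar R).
Implicit Types f h : L1fun w.

(** Functions [t] with t / w bounded define functionals on L^1(G, w): the integrand is dominated by
    C |f| w. *)
Lemma cintegrable_L1fun f (t : L3 R -> R[i]) (C : R) : cmeasurable t ->
  (forall x, Normc.normc (t x) <= C * w x) -> cintegrable (fun x => f x * t x).
Proof.
move=> mt tC; apply: (@le_cintegrable _ _ (fun x => C * wabs w f x)).
- by apply: cmeasurableM => //; exact: L1fun_cmeasurable.
- rewrite (_ : _ \o _ = (fun x => C%:E * (wabs w f x)%:E)%E).
    by apply: integrableZl => //; exact: L1fun_integrable.
  by apply/funext => x; rewrite /= EFinM.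
- move=> x; rewrite Normc.normcM /wabs mulrCA.
  by rewrite ler_wpM2l ?normc_ge0.
Qed.

Lemma haar_integral_L1fun_le f (t : L3 R -> R[i]) (C : R) : cmeasurable t ->
  (forall x, Normc.normc (t x) <= C * w x) ->
  Normc.normc (haar_integral (fun x => f x * t x)) <= 2 * (C * wnorm w f).
Proof.
move=> mt tC; rewrite /wnorm -RintegralZl//; last exact: L1fun_integrable.
apply: haar_integral_le.
- by apply: cmeasurableM => //; exact: L1fun_cmeasurable.
- rewrite (_ : _ \o _ = (fun x => C%:E * (wabs w f x)%:E)%E).
    by apply: integrableZl => //; exact: L1fun_integrable.
  by apply/funext => x; rewrite /= EFinM.
- move=> x; rewrite Normc.normcM /wabs mulrCA.
  by rewrite ler_wpM2l ?normc_ge0.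
Qed.

Let div (z : L3 R * L3 R) : L3 R := hmul (hinv z.2) z.1.

Let mdiv : measurable_fun setT div.
Proof.
apply: hmul_measurable; last exact: measurable_fst.
apply: (measurableT_comp hinv_measurable); exact: measurable_snd.
Qed.

Let wabs_mfun f : measurable_fun setT (wabs w f : L3 R -> R).
Proof. by apply: wabs_measurable; exact: L1fun_cmeasurable. Qed.

(** Tonelli with z.1 as the inner variable: left invariance turns the inner integral of the second
    factor into [wnorm w h] for every z.2, and [wabs w f] remains. *)
Let integrable_conv_kernel f h :
  (haarR \x haarR)%E.-integrable setT
    (fun z => (wabs w f z.2 * wabs w h (div z))%:E).
Proof.
have mh := measurableT_comp (@wabs_mfun h) mdiv.
apply/integrable21ltyP.
  apply/measurable_EFinP; apply: measurable_funM => //.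
  exact: (measurableT_comp (@wabs_mfun f) measurable_snd).
rewrite (_ : (\int[haarR]_y _)%E =
    (\int[haarR]_y ((wabs w f y)%:E * (wnorm w h)%:E))%E); last first.
  apply: eq_integral => y _.
  rewrite (_ : (\int[haarR]_x _)%E = (\int[haarR]_x
      ((wabs w f y)%:E * (wabs w h (div (x, y)))%:E))%E); last first.
    apply: eq_integral => x _.
    by rewrite -EFinM gee0_abs// lee_fin mulr_ge0 ?wabs_ge0.
  rewrite ge0_integralZl ?lee_fin ?wabs_ge0//; last 2 first.
  - apply/measurable_EFinP.
    exact: (measurable_fun_pair1 _ mh).
  - by move=> x _; rewrite lee_fin wabs_ge0.
  congr (_ * _)%E; rewrite wnormE.
  rewrite -[RHS](@haar_left_invariant _ (fun x => (wabs w h x)%:E) (hinv y))//.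
  - exact/measurable_EFinP.
  - by move=> x; rewrite lee_fin wabs_ge0.
rewrite ge0_integralZr//; first last.
- by rewrite lee_fin; apply: Rintegral_ge0 => x _; exact: wabs_ge0.
- by move=> y _; rewrite lee_fin wabs_ge0.
- exact/measurable_EFinP.
by rewrite -wnormE -EFinM ltry.
Qed.

(** Fubini, followed by the substitution z = yx that left invariance allows. The kernel is dominated
    because w(z) <= w(y) w(y^-1 z). *)
Lemma haar_integral_conv f h (t : L3 R -> R[i]) (C : R) : cmeasurable t ->
  (forall x, Normc.normc (t x) <= C * w x) ->
  haar_integral (fun z => Defs.conv f h z * t z) =
  haar_integral (fun y => f y * haar_integral (fun x => h x * t (hmul y x))).
Proof.
move=> mt tC.
have mf : cmeasurable (fun z : L3 R * L3 R => f z.2).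
  exact: cmeasurable_comp (L1fun_cmeasurable f) measurable_snd.
have mh := cmeasurable_comp (L1fun_cmeasurable h) mdiv.
have mK := cmeasurableM mf mh.
have ntM (s : L3 R -> R[i]) (B : R) : cmeasurable s ->
    (forall x, Normc.normc (s x) <= B * w x) ->
    forall z, Normc.normc (s z.1 * (f z.2 * h (div z))) <=
      B * (wabs w f z.2 * wabs w h (div z)).
  move=> ms sB [z y] /=; rewrite !Normc.normcM /wabs.
  rewrite [leRHS](_ : _ = B * (w y * w (div (z, y))) *
    (Normc.normc (f y) * Normc.normc (h (div (z, y))))); last by ring.
  rewrite ler_wpM2r ?mulr_ge0 ?normc_ge0//.
  have B0 : 0 <= B.
    by rewrite -(pmulr_lge0 _ (weight_gt0 w z)) (le_trans (normc_ge0 _) (sB z)).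
  rewrite (le_trans (sB z))// ler_wpM2l//.
  by rewrite -[in leLHS](_ : hmul y (div (z, y)) = z) ?weight_hmul//
    /div/= hmulA hmulxV hmul1.
have iH (B : R) : (haarR \x haarR)%E.-integrable setT
    (EFin \o (fun z => B * (wabs w f z.2 * wabs w h (div z)))).
  rewrite (_ : _ \o _ = (fun z => B%:E * (wabs w f z.2 * wabs w h (div z))%:E)%E).
    by apply: integrableZl => //; exact: integrable_conv_kernel.
  by apply/funext => z; rewrite /= EFinM.
have mtK : cmeasurable (fun z : L3 R * L3 R => t z.1 * (f z.2 * h (div z))).
  by apply: cmeasurableM => //; apply: cmeasurable_comp.
(* The estimate [ntM] serves for two multipliers, [t] and [w] itself. As [w] never vanishes it can
   be divided out, which gives integrability of the bare convolution kernel for almost every z, even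
   where [t] is zero. *)
have mw : @cmeasurable _ (L3 R) R (fun x => (w x)%:C%C).
  by split => /=; [exact: weight_measurable|exact: measurable_cst].
have nw x : Normc.normc (w x)%:C%C <= 1 * w x.
  by rewrite normc_real gtr0_norm ?weight_gt0// mul1r.
have mwK : cmeasurable (fun z : L3 R * L3 R => (w z.1)%:C%C * (f z.2 * h (div z))).
  by apply: cmeasurableM => //; apply: (cmeasurable_comp mw).
(* Where the integral defining conv f h z diverges, conv f h z is a junk value
   and t z cannot be moved inside: the equality below only holds almost
   everywhere. *)
have ae_int := ae_cintegrable mwK (iH 1) (ntM _ _ mw nw).
transitivity (haar_integral (fun z => haar_integral (fun y =>
    t z * (f y * h (div (z, y)))))).
  apply: ae_eq_haar_integral.
  - by apply: cmeasurableM => //; exact: (L1fun_cmeasurable (L1_conv_fun f h)).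
  - exact: (cmeasurable_haar_integral mtK).
  apply: filterS ae_int => z /= iz; rewrite mulrC -haar_integralZl//.
  have w0 : (w z)%:C%C != 0 by rewrite eq_complex /= eqxx andbT gt_eqF ?weight_gt0.
  rewrite (_ : (fun y => _) =
      fun y => (w z)%:C%C^-1 * ((w z)%:C%C * (f y * h (div (z, y))))).
    exact: cintegrableZl.
  by apply/funext => y; rewrite mulKf.
rewrite (haar_integral_Fubini mtK (iH C) (ntM _ _ mt tC)).
apply: eq_haar_integral => y.
have iy : cintegrable (fun x => h x * t (hmul y x)).
  apply: (@cintegrable_L1fun _ _ (C * w y)).
    by apply: cmeasurable_comp => //; exact: hmul_measurable.
  move=> x; rewrite (le_trans (tC _))// -mulrA ler_wpM2l ?weight_hmul//.
  by rewrite -(pmulr_lge0 _ (weight_gt0 w y)) (le_trans (normc_ge0 _) (tC y)).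
rewrite -haar_integralZl//.
rewrite -(@haar_integral_shift _ _ (hinv y) (cintegrableZl (f y) iy)).
apply: eq_haar_integral => z; rewrite /div /= hmulA hmulxV hmul1.
by rewrite [LHS]mulrC mulrA.
Qed.

End convolution_pairing.

(** * Growth of the weight, and the function F *)

Section weight_growth.
Context {R : realType} (w : weight R).
Hypothesis w_abs : forall u v t : R, w (u, v, t) = w (`|u|, `|v|, 0).
Hypothesis w_lim : forall M : R, exists N : R, forall x y : R,
  0 <= x -> 0 <= y -> N <= x + y -> M <= w (x, y, 0).

(** Submultiplicativity at the identity gives w(1) >= 1. By symmetry x and its inverse have the same
    weight, so w(x)^2 >= w(1). *)
Lemma weight_ge1 x : 1 <= w x.
Proof.
have sqr_ge1 (r : R) : 0 < r -> 1 <= r * r -> 1 <= r.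
  by move=> r0; rewrite -expr2 expr_ge1// ltW.
have w1 : 1 <= w hone.
  have := weight_hmul w hone hone.
  by rewrite hmul1 -[X in X <= _]mul1r ler_pM2r ?weight_gt0.
apply: (sqr_ge1 _ (weight_gt0 w x)); apply: (le_trans w1).
have := weight_hmul w x (hinv x); rewrite hmulxV; move/le_trans; apply.
by case: x => -[u v] t; rewrite /hinv/= (w_abs (- u)) (w_abs u) !normrN.
Qed.

(** [t] enters without absolute value so that these sets decrease in [t]; the infimum is then
    monotone, hence measurable. *)
Definition log_weights (t : R) : set R :=
  [set r | exists p : R * R,
    [/\ 0 <= p.1, 0 <= p.2, t <= p.1 + p.2 & r = ln (w (p, 0))]].

(** This is F. The set is nonempty and bounded below by 0, so [inf] is a genuine infimum and not a
    default value. *)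
Definition min_log_weight (t : R) : R := inf (log_weights `|t|).

Let has_inf_log_weights t : has_inf (log_weights t).
Proof.
split.
- by exists (ln (w (`|t|, 0, 0))), (`|t|, 0); split; rewrite //= addr0 ler_norm.
- by exists 0 => _ [p [_ _ _ ->]]; rewrite ln_ge0 ?weight_ge1.
Qed.

Lemma min_log_weight_le x y t r : 0 <= x -> 0 <= y -> `|t| <= x + y ->
  min_log_weight t <= ln (w (x, y, r)).
Proof.
move=> x0 y0 txy; apply: inf_lbound; first exact: (has_inf_log_weights `|t|).2.
by exists (x, y); split => //; rewrite w_abs !ger0_norm.
Qed.

Lemma le_min_log_weight r t :
  (forall x y, 0 <= x -> 0 <= y -> `|t| <= x + y -> r <= ln (w (x, y, 0))) ->
  r <= min_log_weight t.
Proof.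
move=> rw; apply: lb_le_inf; first exact: (has_inf_log_weights `|t|).1.
by move=> _ [[x y] [/= x0 y0 txy ->]]; exact: rw.
Qed.

(** If (x, y) competes for t, the product of (x, y, 0) and (|u|, |v|, 0) has first coordinates x +
    |u| and y + |v|, which compete for t + s; the absolute values exclude cancellation.
    Submultiplicativity bounds its weight. *)
Lemma min_log_weightD t s u v r : `|s| <= `|u| + `|v| ->
  min_log_weight (t + s) <= min_log_weight t + ln (w (u, v, r)).
Proof.
move=> suv; rewrite -lerBlDr; apply: le_min_log_weight => x y x0 y0 txy.
rewrite lerBlDr -lnM ?posrE ?weight_gt0//.
apply: (@le_trans _ _ (ln (w (hmul (x, y, 0) (`|u|, `|v|, 0))))).
  apply: min_log_weight_le; rewrite ?addr_ge0//=.
  rewrite (le_trans (ler_normD _ _))// addrACA.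
  exact: lerD.
rewrite ler_ln ?posrE ?mulr_gt0 ?weight_gt0// (w_abs u v).
exact: weight_hmul.
Qed.

Lemma min_log_weight_dist t s u v r : `|t - s| <= `|u| + `|v| ->
  `|min_log_weight t - min_log_weight s| <= ln (w (u, v, r)).
Proof.
move=> tsuv; rewrite ler_norml; apply/andP; split.
- rewrite lerBrDl lerBlDr -{1}(subrKC t s).
  by apply: min_log_weightD; rewrite distrC.
- rewrite lerBlDl -{1}(subrKC s t).
  exact: min_log_weightD.
Qed.

Lemma measurable_min_log_weight : measurable_fun setT min_log_weight.
Proof.
apply: (@measurableT_comp _ _ _ _ _ _ (fun t => inf (log_weights t))).
  apply: nondecreasing_measurable => // s t st.
  apply: lb_le_inf; first exact: (has_inf_log_weights t).1.
  move=> _ [[x y] [/= x0 y0 txy ->]].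
  apply: inf_lbound; first exact: (has_inf_log_weights s).2.
  by exists (x, y); split => //; exact: le_trans st txy.
exact: normr_measurable.
Qed.

Lemma min_log_weight_infty M : exists T, forall t, T <= `|t| ->
  M <= min_log_weight t.
Proof.
have [N Nw] := w_lim (expR M); exists N => t Nt.
apply: le_min_log_weight => x y x0 y0 txy.
rewrite -[leLHS]expRK ler_ln ?posrE ?expR_gt0 ?weight_gt0//.
by apply: Nw => //; exact: le_trans Nt txy.
Qed.

End weight_growth.

(** * Iterated integrals of L^1 functions against kernels *)

Section bilinear_forms.
Context {R : realType} (w : weight R).
Local Notation haarR := (@haar R).
Implicit Types f h : L1fun w.

(** Integrating out one variable keeps measurability in the parameter and trades the factor [w x] of
    the bound for a constant, so that iterated integrals can be treated from the inside out. *)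
Lemma L1fun_param d (P : measurableType d) h (K : P -> L3 R -> R[i]) (b : P -> R) :
  cmeasurable (fun z : P * L3 R => K z.1 z.2) ->
  (forall p x, Normc.normc (K p x) <= b p * w x) ->
  [/\ cmeasurable (fun p => haar_integral (fun x => h x * K p x)),
      forall p, Normc.normc (haar_integral (fun x => h x * K p x)) <=
                2 * wnorm w h * b p
    & forall p, cintegrable (fun x => h x * K p x)].
Proof.
move=> mK Kb.
have mKp p : cmeasurable (K p).
  apply: (cmeasurable_comp (p := fun x => (p, x)) mK).
  exact: measurable_fun_pair.
split=> [|p|p].
- apply: (@cmeasurable_haar_integral _ _ _ (fun z : P * L3 R => h z.2 * K z.1 z.2)).
  apply: cmeasurableM => //.
  exact: cmeasurable_comp (L1fun_cmeasurable h) measurable_snd.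
- by rewrite -mulrA (mulrC _ (b p)); apply: haar_integral_L1fun_le.
- exact: cintegrable_L1fun (Kb p).
Qed.

Lemma haar_integral_swap f h (K : L3 R -> L3 R -> R[i]) (C : R) :
  cmeasurable (fun z : L3 R * L3 R => K z.1 z.2) ->
  (forall x y, Normc.normc (K x y) <= C * (w x * w y)) ->
  haar_integral (fun x => f x * haar_integral (fun y => h y * K x y)) =
  haar_integral (fun y => h y * haar_integral (fun x => f x * K x y)).
Proof.
move=> mK KC.
have mKx x : cmeasurable (K x).
  apply: (cmeasurable_comp (p := fun y => (x, y)) mK).
  exact: measurable_fun_pair.
have mKy y : cmeasurable (K ^~ y).
  apply: (cmeasurable_comp (p := fun x => (x, y)) mK).
  exact: measurable_fun_pair.
pose k (z : L3 R * L3 R) := f z.1 * h z.2 * K z.1 z.2.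
have mk : cmeasurable k.
  apply: cmeasurableM => //; apply: cmeasurableM.
  - exact: (cmeasurable_comp (L1fun_cmeasurable f) measurable_fst).
  - exact: (cmeasurable_comp (L1fun_cmeasurable h) measurable_snd).
transitivity (haar_integral (fun x => haar_integral (fun y => k (x, y)))).
  apply: eq_haar_integral => x; rewrite -haar_integralZl.
    by apply: eq_haar_integral => y; rewrite /k /= mulrA.
  by apply: (@cintegrable_L1fun _ _ _ _ (C * w x)) => // y; rewrite -mulrA.
rewrite (@haar_integral_Fubini _ k (fun z => C * (wabs w f z.1 * wabs w h z.2)) mk).
- apply: eq_haar_integral => y; rewrite -haar_integralZl.
    by apply: eq_haar_integral => x; rewrite /k /= mulrAC mulrC mulrA.
  apply: (@cintegrable_L1fun _ _ _ _ (C * w y)) => // x.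
  by rewrite -mulrA (mulrC (w y)).
- rewrite (_ : _ \o _ = (fun z => C%:E * (wabs w f z.1 * wabs w h z.2)%:E)%E).
    by apply: integrableZl => //; apply: integrable_prod; exact: L1fun_integrable.
  by apply/funext => z; rewrite /= EFinM.
- move=> z; rewrite /k !Normc.normcM /wabs.
  rewrite [leRHS](_ : _ = Normc.normc (f z.1) * Normc.normc (h z.2) *
    (C * (w z.1 * w z.2))); last by ring.
  by rewrite ler_wpM2l// mulr_ge0 ?normc_ge0.
Qed.

Definition trilinear_kernel (K : L3 R -> L3 R -> L3 R -> R[i]) :=
  cmeasurable (fun z : L3 R * L3 R * L3 R => K z.1.1 z.1.2 z.2) /\
  forall x y z, Normc.normc (K x y z) <= w x * w y * w z.

Definition trilinear (f1 f2 f3 : L1fun w) (K : L3 R -> L3 R -> L3 R -> R[i]) :=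
  haar_integral (fun x => f1 x * haar_integral (fun y => f2 y *
    haar_integral (fun z => f3 z * K x y z))).

Lemma trilinearD f1 f2 f3 K K1 K2 :
  trilinear_kernel K1 -> trilinear_kernel K2 ->
  (forall x y z, K x y z = K1 x y z + K2 x y z) ->
  trilinear f1 f2 f3 K = trilinear f1 f2 f3 K1 + trilinear f1 f2 f3 K2.
Proof.
(* Additivity is applied to each of the three nested integrals, so each integrand must be
   integrable: first in z with the pair (x, y) as parameter, then in y, then in x. *)
have int (J : L3 R -> L3 R -> L3 R -> R[i]) : trilinear_kernel J ->
    let J3 x y := haar_integral (fun z => f3 z * J x y z) in
    let J2 x := haar_integral (fun y => f2 y * J3 x y) in
    [/\ cintegrable (fun x => f1 x * J2 x),
        forall x, cintegrable (fun y => f2 y * J3 x y)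
      & forall x y, cintegrable (fun z => f3 z * J x y z)].
  move=> [mJ nJ] J3 J2.
  have [m3 n3 c3] := @L1fun_param _ (L3 R * L3 R)%type f3
    (fun p => J p.1 p.2) (fun p => w p.1 * w p.2) mJ (fun p => nJ p.1 p.2).
  have n3' x y : Normc.normc (J3 x y) <= 2 * wnorm w f3 * w x * w y.
    by rewrite -mulrA; exact: (n3 (x, y)).
  have [m2 n2 c2] := @L1fun_param _ (L3 R) f2 J3 _ m3 n3'.
  split=> [|x|x y].
  - apply: (@cintegrable_L1fun _ _ _ _ (2 * wnorm w f2 * (2 * wnorm w f3))) => // x.
    by rewrite -mulrA; exact: n2.
  - exact: c2.
  - exact: (c3 (x, y)).
move=> /int[i1 j1 k1] /int[i2 j2 k2] KE.
apply: etrans (haar_integralD i1 i2); apply: eq_haar_integral => x.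
rewrite -mulrDr; congr (_ * _).
apply: etrans (haar_integralD (j1 x) (j2 x)); apply: eq_haar_integral => y.
rewrite -mulrDr; congr (_ * _).
apply: etrans (haar_integralD (k1 x y) (k2 x y)); apply: eq_haar_integral => z.
by rewrite -mulrDr KE.
Qed.

End bilinear_forms.

(** * The bilinear form of a cocycle and its Leibniz rule *)

Section cocycle_form.
Context {R : realType} (w : weight R) (d : L3 R -> L3 R -> R).
Local Notation haarR := (@haar R).
Implicit Types f h : L1fun w.
Hypothesis md : measurable_fun setT (fun z : L3 R * L3 R => d z.1 z.2).
Hypothesis dw : forall g x, `|d g x| <= w g * w x.
Hypothesis d_cocycle : forall g k x,
  d (hmul g k) x = d k (hmul x g) + d g (hmul k x).

Local Notation dc g x := ((d g x)%:C%C).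

Let mdc : cmeasurable (fun z : L3 R * L3 R => dc z.1 z.2).
Proof. by split => //=; exact: measurable_cst. Qed.

Let mdc_comp d' (T : measurableType d') (a b : T -> L3 R) :
  measurable_fun setT a -> measurable_fun setT b ->
  cmeasurable (fun t => dc (a t) (b t)).
Proof.
move=> ma mb; apply: (cmeasurable_comp (p := fun t => (a t, b t)) mdc).
exact: measurable_fun_pair.
Qed.

Let ndc g x : Normc.normc (dc g x) <= w g * w x.
Proof. by rewrite normc_real. Qed.

Definition form_inner (h : L3 R -> R[i]) (g : L3 R) : R[i] :=
  haar_integral (fun x => h x * (d g x)%:C%C).

(** [d g x] stands for the value of a derivation at the point masses at g and x, for which
    [d_cocycle] is the Leibniz rule; [form] extends this to L^1(G, w). *)
Definition form f h : R[i] := haar_integral (fun g => f g * form_inner h g).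

Let form_inner_param h :
  [/\ cmeasurable (form_inner h),
      forall g, Normc.normc (form_inner h g) <= 2 * wnorm w h * w g
    & forall g, cintegrable (fun x => h x * dc g x)].
Proof. exact: L1fun_param mdc ndc. Qed.

Lemma form_inner_measurable h : cmeasurable (form_inner h).
Proof. by have [] := form_inner_param h. Qed.

Lemma form_inner_le h g : Normc.normc (form_inner h g) <= 2 * wnorm w h * w g.
Proof. by have [_ +] := form_inner_param h; exact. Qed.

Lemma cintegrable_form_inner h g : cintegrable (fun x => h x * dc g x).
Proof. by have [_ _ +] := form_inner_param h; exact. Qed.

Lemma cintegrable_form f h : cintegrable (fun g => f g * form_inner h g).
Proof. exact: cintegrable_L1fun (form_inner_measurable h) (form_inner_le h). Qed.

Lemma form_le f h : Normc.normc (form f h) <= 4 * (wnorm w f * wnorm w h).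
Proof.
rewrite [leRHS](_ : _ = 2 * (2 * wnorm w h * wnorm w f)); last by ring.
exact: (haar_integral_L1fun_le f (form_inner_measurable h) (form_inner_le h)).
Qed.

Lemma form_ae f f' h h' :
  (\forall x \ae haarR, f x = f' x) -> (\forall x \ae haarR, h x = h' x) ->
  form f h = form f' h'.
Proof.
move=> ff' hh'; apply: ae_eq_haar_integral.
- by apply: cmeasurableM; [exact: L1fun_cmeasurable|exact: form_inner_measurable].
- by apply: cmeasurableM; [exact: L1fun_cmeasurable|exact: form_inner_measurable].
apply: filterS ff' => g ->; congr (_ * _); apply: ae_eq_haar_integral.
- exact: cintegrable_cmeasurable (cintegrable_form_inner h g).
- exact: cintegrable_cmeasurable (cintegrable_form_inner h' g).
by apply: filterS hh' => x ->.
Qed.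

Lemma formDl (a : R[i]) f f' h : form (a *: f + f') h = a * form f h + form f' h.
Proof.
have cf := cintegrable_form; have ci := cintegrable_form_inner.
rewrite /form -haar_integralZl// -haar_integralD//; last exact: cintegrableZl.
by apply: eq_haar_integral => g; rewrite [in LHS]/= mulrA -mulrDl.
Qed.

Lemma formDr (a : R[i]) f h h' : form f (a *: h + h') = a * form f h + form f h'.
Proof.
have cf := cintegrable_form; have ci := cintegrable_form_inner.
rewrite /form -haar_integralZl// -haar_integralD//; last exact: cintegrableZl.
apply: eq_haar_integral => g; rewrite mulrCA -mulrDr; congr (_ * _).
rewrite /form_inner -haar_integralZl// -haar_integralD//; last exact: cintegrableZl.
by apply: eq_haar_integral => x; rewrite [in LHS]/= mulrA -mulrDl.
Qed.

Let w_ge0 x : 0 <= w x. Proof. exact/ltW/weight_gt0. Qed.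

Let mproj (T := (L3 R * L3 R * L3 R)%type) :
  [/\ measurable_fun setT (fun z : T => z.1.1),
      measurable_fun setT (fun z : T => z.1.2)
    & measurable_fun setT (fun z : T => z.2)].
Proof. by split => //; exact: measurableT_comp. Qed.

(** All three terms become integrals of f1(g) f2(k) h(x) against kernels in (g, k, x), and these
    kernels are related by [d_cocycle]. *)
Lemma form_conv f1 f2 h :
  form (L1_conv_fun f1 f2) h =
  form f2 (L1_conv_fun h f1) + form f1 (L1_conv_fun f2 h).
Proof.
have [m1 m2 m3] := mproj.
have k1 : trilinear_kernel w (fun g k x => dc k (hmul x g)).
  split=> [|g k x]; first by apply: mdc_comp => //; exact: hmul_measurable.
  rewrite (le_trans (ndc _ _))// (mulrC (w g)) -mulrA ler_wpM2l//.
  by rewrite mulrC weight_hmul.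
have k2 : trilinear_kernel w (fun g k x => dc g (hmul k x)).
  split=> [|g k x]; first by apply: mdc_comp => //; exact: hmul_measurable.
  by rewrite (le_trans (ndc _ _))// -mulrA ler_wpM2l// weight_hmul.
have mdk k : cmeasurable (fun x => dc k x).
  by apply: mdc_comp => //; exact: measurable_cst.
have -> : form f2 (L1_conv_fun h f1) =
    trilinear f1 f2 h (fun g k x => dc k (hmul x g)).
  (* Unfolding the convolution yields integrations over k, x, g in this order. Exchanging x with g,
     then g with k, restores the order g, k, x. *)
  pose E g k := haar_integral (fun x => h x * dc k (hmul x g)).
  have [mE nE _] := @L1fun_param _ _ _ (L3 R * L3 R)%type h
    (fun p x => dc p.2 (hmul x p.1)) (fun p => w p.1 * w p.2) k1.1
    (fun p => k1.2 p.1 p.2).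
  apply/esym.
  apply: (etrans (@haar_integral_swap _ _ f1 f2 E _ mE (fun g k => nE (g, k)))).
  apply: eq_haar_integral => k; congr (_ * _); apply/esym.
  transitivity (haar_integral (fun x => h x *
      haar_integral (fun g => f1 g * dc k (hmul x g)))).
    exact: haar_integral_conv (mdk k) (ndc k).
  apply: (@haar_integral_swap _ _ h f1 (fun x g => dc k (hmul x g)) (w k)).
    by apply: mdc_comp; [exact: measurable_cst|exact: hmul_measurable].
  by move=> x g; rewrite (le_trans (ndc _ _))// ler_wpM2l// weight_hmul.
have -> : form f1 (L1_conv_fun f2 h) =
    trilinear f1 f2 h (fun g k x => dc g (hmul k x)).
  apply: eq_haar_integral => g; congr (_ * _).
  exact: haar_integral_conv (mdk g) (ndc g).
have kE g k x : dc (hmul g k) x = dc k (hmul x g) + dc g (hmul k x).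
  by rewrite d_cocycle rmorphD.
apply: etrans (trilinearD f1 f2 h k1 k2 kE).
(* On the left-hand side the function paired with the convolution is [form_inner d h], which is then
   evaluated at gk. *)
exact: haar_integral_conv (form_inner_measurable h) (form_inner_le h).
Qed.

End cocycle_form.

(** * Bounded functionals and continuity into the dual *)

Section bounded_functionals.
Context {K : numFieldType} (A : normedModType K).

Lemma bounded_linear_dual (f : A -> K) (C : K) : 0 <= C ->
  (forall k a b, f (k *: a + b) = k * f a + f b) ->
  (forall a, `|f a| <= C * `|a|) -> exists phi : dual A, phi =1 f.
Proof.
move=> C0 lf fC.
pose g : A -> K^o := f.
pose G : {linear A -> K^o} := HB.pack g (GRing.isLinear.Build K A K^o _ g lf).
have cG : continuous G.
  apply/linear_bounded_continuous/linear_boundedP; near=> r => x.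
  rewrite (le_trans (fC x))// ler_wpM2r//.
  by near: r; apply: nbhs_pinfty_ge; exact: ger0_real.
by exists (Dual cG).
Unshelve. all: by end_near. Qed.

Lemma dual_bounded (phi : dual A) :
  exists2 C : K, 0 < C & forall a, `|phi a| <= C * `|a|.
Proof.
have /linear_bounded_continuous/linear_boundedP := @dual_continuous _ _ phi.
by move=> /pinfty_ex_gt0[C C0 phiC]; exists C.
Qed.

Lemma bounded_continuous_to_dual (D : A -> dual A) (C : K) : 0 < C ->
  linear_to_dual D -> (forall a x, `|D a x| <= C * (`|a| * `|x|)) ->
  continuous_to_dual D.
Proof.
move=> C0 lD DC a e e0; near=> b => x x1.
have -> : D b x - D a x = D (b - a) x.
  by rewrite (addrC b) -(scaleN1r a) (lD (- 1) a b x) mulN1r addrC.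
apply: (le_trans (DC _ _)); rewrite -ler_pdivlMl//.
apply: (@le_trans _ _ (`|b - a| * 1)); first exact: ler_wpM2l.
rewrite mulr1 distrC mulrC.
near: b; exact: cvgr_dist_le (divr_gt0 e0 C0).
Unshelve. all: by end_near. Qed.

End bounded_functionals.

(** * The derivation given by a cocycle *)

Section cocycle_derivation.
Context {R : realType} (w : weight R) (d : L3 R -> L3 R -> R).
Hypothesis md : measurable_fun setT (fun z : L3 R * L3 R => d z.1 z.2).
Hypothesis dw : forall g x, `|d g x| <= w g * w x.
Hypothesis d_cocycle : forall g k x,
  d (hmul g k) x = d k (hmul x g) + d g (hmul k x).
Local Open Scope quotient_scope.

Lemma repr_L1D (a : R[i]) (u v : L1 w) :
  \forall x \ae @haar R, repr (a *: u + v) x = (a *: repr u + repr v) x.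
Proof.
have -> : a *: u + v = \pi_(L1 w) (a *: repr u + repr v).
  by rewrite L1_piD L1_piZ !reprK.
exact: repr_L1.
Qed.

Lemma L1_normE (u : L1 w) : `|u| = (wnorm w (repr u))%:C%C.
Proof. by []. Qed.

(** The last clause lets [D] be evaluated on explicit functions, such as indicators. *)
Lemma cocycle_derivation : exists D : L1 w -> dual (L1 w),
  [/\ linear_to_dual D, continuous_to_dual D, derivation (@L1_mul R w) D
    & forall f h, D (\pi_(L1 w) f) (\pi_(L1 w) h) = form d f h].
Proof.
(* The form is taken on chosen representatives; [BE] shows that the choice does not matter. *)
pose B (u v : L1 w) := form d (repr u) (repr v).
have BE f h : B (\pi_(L1 w) f) (\pi_(L1 w) h) = form d f h.
  exact: (form_ae md dw (repr_L1 f) (repr_L1 h)).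
have ae_refl (f : L1fun w) : \forall x \ae @haar R, f x = f x by exact: nearW.
have Bl k a b x : B (k *: a + b) x = k * B a x + B b x.
  by rewrite /B -(formDl md dw) (form_ae md dw (repr_L1D k a b) (ae_refl _)).
have Br u k a b : B u (k *: a + b) = k * B u a + B u b.
  by rewrite /B -(formDr md dw) (form_ae md dw (ae_refl _) (repr_L1D k a b)).
have Ble u v : `|B u v| <= 4%:C%C * (`|u| * `|v|).
  rewrite !L1_normE normr_normc -!rmorphM /= lecR.
  exact: (form_le md dw).
have BD u : exists phi : dual (L1 w), phi =1 B u.
  apply: (@bounded_linear_dual _ _ _ (4%:C%C * `|u|)).
  - by rewrite mulr_ge0// lecR.
  - exact: Br.
  - by move=> v; rewrite -mulrA.
have [D DE] := choice BD.
have lD : linear_to_dual D by move=> k a b x; rewrite !DE.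
exists D; split=> //.
- apply: (@bounded_continuous_to_dual _ _ _ 4%:C%C) => //.
    by rewrite ltcR.
  by move=> a x; rewrite DE.
- move=> a b x; rewrite /lact /ract !DE -(reprK a) -(reprK b) -(reprK x).
  rewrite !L1_mul_pi !BE; exact: (form_conv md dw d_cocycle).
- by move=> f h; rewrite DE BE.
Qed.

End cocycle_derivation.

(** * Indicators of sets of finite measure *)

Section indicator_integrals.
Context {R : realType}.
Local Notation haarR := (@haar R).
Variable A : set (L3 R).
Hypotheses (mA : measurable A) (Aoo : (haarR A < +oo)%E).

Let indic_integrable (c : R) : haarR.-integrable setT (fun x => (c * \1_A x)%:E).
Proof.
rewrite (_ : (fun x => _) = (fun x => c%:E * (\1_A x)%:E)%E); last first.
  by apply/funext => x; rewrite EFinM.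
apply: integrableZl => //; apply/integrableP; split.
  exact/measurable_EFinP/measurable_indic.
under eq_integral => x _ do rewrite gee0_abs ?lee_fin//.
by rewrite integral_indic// setIT.
Qed.

Let Rintegral_indic (c : R) : \int[haarR]_x (c * \1_A x) = c * fine (haarR A).
Proof.
rewrite RintegralZl//; last first.
  rewrite (_ : _ \o _ = (fun x => (1 * \1_A x)%:E))//.
  by apply/funext => x; rewrite /= mul1r.
by rewrite /Rintegral integral_indic// setIT.
Qed.

Lemma cmeasurable_indic : cmeasurable (fun x : L3 R => (\1_A x : R)%:C%C).
Proof. by split => /=; [exact: measurable_indic|exact: measurable_cst]. Qed.

Lemma haar_integral_indic_le (G : L3 R -> R[i]) (c : R) : cmeasurable G ->
  (forall y, A y -> Normc.normc (G y) <= c) ->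
  Normc.normc (haar_integral (fun y => (\1_A y : R)%:C%C * G y)) <=
    2 * (c * fine (haarR A)).
Proof.
move=> mG Gc; rewrite -Rintegral_indic; apply: haar_integral_le => //.
- by apply: cmeasurableM => //; exact: cmeasurable_indic.
- exact: indic_integrable.
move=> y; rewrite Normc.normcM normc_real ger0_norm// mulrC indicE.
by case: (boolP (y \in A)) => [/set_mem/Gc|_]; rewrite ?mulr1// !mulr0.
Qed.

Lemma haar_integral_indic_ge (G : L3 R -> R[i]) (c : R) :
  cintegrable (fun y => (\1_A y : R)%:C%C * G y) ->
  (forall y, A y -> c <= complex.Re (G y)) ->
  c * fine (haarR A) <= complex.Re (haar_integral (fun y => (\1_A y : R)%:C%C * G y)).
Proof.
move=> [iG _] Gc; rewrite -Rintegral_indic /=; apply: le_Rintegral => //.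
  exact: indic_integrable.
move=> y _; rewrite indicE; case: (boolP (y \in A)) => [/set_mem/Gc|_].
  by rewrite mulr1; case: (G y) => u v; rewrite /= mul1r mul0r subr0.
by rewrite mulr0; case: (G y) => u v; rewrite /= !mul0r subr0.
Qed.

Context (w : weight R).

Lemma indic_L1 (c : R) : (forall x, A x -> w x <= c) ->
  (fun x => (\1_A x : R)%:C%C) \in L1_pred w.
Proof.
move=> wc; rewrite inE; split; first exact: cmeasurable_indic.
have mwA := wabs_measurable w cmeasurable_indic.
apply: le_integrable (indic_integrable c) => //; first exact/measurable_EFinP.
move=> x _; rewrite /= lee_fin ger0_norm ?wabs_ge0// /wabs normc_real ger0_norm//.
rewrite (le_trans _ (ler_norm _))// mulrC indicE.
by case: (boolP (x \in A)) => [/set_mem/wc|_]; rewrite ?mulr1// !mulr0.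
Qed.

End indicator_integrals.

Lemma weight_bounded (R : realType) (w : weight R) (N : R) :
  exists K : R, forall x, `|x.1.1| <= N -> `|x.1.2| <= N -> `|x.2| <= N -> w x <= K.
Proof.
pose I : set R := `[- N, N]%classic.
have cI : compact I by exact: segment_compact.
have cX : compact ((I `*` I) `*` I) by apply: compact_setX => //; exact: compact_setX.
have cw : compact (w @` ((I `*` I) `*` I) : set R^o).
  apply: continuous_compact => //; apply: continuous_subspaceT.
  exact: weight_continuous.
(* [compact_bounded] yields bounds by the numbers strictly above [K], hence [K + 1]. *)
have [K [_ wK]] := compact_bounded cw; exists (K + 1) => x x1 x2 x3.
have K1 : K < K + 1 by rewrite ltrDl.
have IP (r : R) : `|r| <= N -> I r by rewrite /I /= in_itv /= ler_norml.
have /(_ (w x)) := wK _ K1.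
rewrite /= ger0_norm ?(ltW (weight_gt0 w x))//; apply.
by exists x => //; split; [split|]; exact: IP.
Qed.

(** * Norms of convolutions of indicators *)

Section convolution_indicators.
Context {R : realType} (w : weight R).
Local Notation haarR := (@haar R).
Variables (A B : set (L3 R)) (f h : L1fun w) (K : R).
Hypotheses (mA : measurable A) (Aoo : (haarR A < +oo)%E).
Hypotheses (mB : measurable B) (Boo : (haarR B < +oo)%E).
Hypotheses (fE : f = (fun x => (\1_A x : R)%:C%C) :> (R * R * R -> R[i])).
Hypotheses (hE : h = (fun x => (\1_B x : R)%:C%C) :> (R * R * R -> R[i])).
Hypothesis wK : forall x y, A x -> B y -> w (hmul x y) <= K.

(** The convolution is real and nonnegative, so its norm is its pairing with [w], which unfolds into
    an integral of w(xy) over A and B. The constant 4 is a factor 2 for each of the two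
    integrals. *)
Lemma wnorm_conv_indic :
  wnorm w (L1_conv_fun f h) <= 4 * K * (fine (haarR A) * fine (haarR B)).
Proof.
have mw : @cmeasurable _ (L3 R) R (fun x => (w x)%:C%C).
  by split => /=; [exact: weight_measurable|exact: measurable_cst].
have nw x : Normc.normc (w x)%:C%C <= 1 * w x.
  by rewrite normc_real gtr0_norm ?weight_gt0// mul1r.
have conv_ge0 z : Normc.normc (L1_conv_fun f h z) = complex.Re (L1_conv_fun f h z).
  rewrite (_ : L1_conv_fun f h z = (\int[haarR]_y
      (\1_A y * \1_B (hmul (hinv y) z)))%:C%C).
    rewrite normc_real ger0_norm//=.
    by apply: Rintegral_ge0 => y _; rewrite mulr_ge0.
  rewrite /= /Defs.conv /haar_integral fE hE; congr Complex.
    by apply: eq_Rintegral => y _; rewrite /= mul0r subr0.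
  transitivity (\int[haarR]_y 0); last by rewrite Rintegral_cst ?mul0r.
  by apply: eq_Rintegral => y _; rewrite /= mulr0 mul0r addr0.
have -> : wnorm w (L1_conv_fun f h) =
    complex.Re (haar_integral (fun z => Defs.conv f h z * (w z)%:C%C)).
  rewrite /wnorm /haar_integral /=; apply: eq_Rintegral => z _.
  rewrite /wabs conv_ge0 /=.
  by case: (Defs.conv f h z) => a b /=; rewrite mulr0 subr0.
apply: (le_trans (ler_norm _)); apply: (le_trans (normr_Re_le _)).
rewrite (haar_integral_conv f h mw nw) fE.
rewrite [leRHS](_ : _ = 2 * (2 * (K * fine (haarR B)) * fine (haarR A))); last by ring.
apply: haar_integral_indic_le => //.
  apply: (@cmeasurable_haar_integral _ _ _ (fun z : L3 R * L3 R =>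
    h z.2 * (w (hmul z.1 z.2))%:C%C)).
  apply: cmeasurableM.
    exact: cmeasurable_comp (L1fun_cmeasurable h) measurable_snd.
  by apply: (cmeasurable_comp mw); exact: hmul_measurable.
move=> y Ay; rewrite hE; apply: haar_integral_indic_le => //.
  by apply: (cmeasurable_comp mw); apply: hmul_measurable => //; exact: measurable_cst.
by move=> x Bx; rewrite normc_real gtr0_norm ?weight_gt0// wK.
Qed.

End convolution_indicators.

(** * Boxes in the group and their measure *)

Section boxes.
Context {R : realType}.

Definition box (a b c : R * R) : set (L3 R) :=
  ([set` `[a.1, a.2]] `*` [set` `[b.1, b.2]]) `*` [set` `[c.1, c.2]].

Lemma boxP a b c x : box a b c x <->
  [/\ a.1 <= x.1.1 <= a.2, b.1 <= x.1.2 <= b.2 & c.1 <= x.2 <= c.2].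
Proof.
rewrite /box /=; split.
  by move=> [[]]; rewrite /= !in_itv /=; split.
by rewrite !in_itv /=; case.
Qed.

Lemma measurable_box a b c : measurable (box a b c).
Proof.
by apply: measurableX; [apply: measurableX|]; exact: measurable_itv.
Qed.

Lemma haar_box a b c : a.1 < a.2 -> b.1 < b.2 -> c.1 < c.2 ->
  haar (box a b c) = ((a.2 - a.1) * (b.2 - b.1) * (c.2 - c.1))%:E.
Proof.
move=> ab bb cb.
have mI (p : R * R) : measurable ([set` `[p.1, p.2]] : set (measurableTypeR R)).
  exact: measurable_itv.
apply: etrans (product_measure1E (@lebesgue2 R) (@lebesgue_measure R)
  (measurableX (mI a) (mI b)) (mI c)) _.
rewrite /= (_ : lebesgue2 _ = (lebesgue_measure [set` `[a.1, a.2]] *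
  lebesgue_measure [set` `[b.1, b.2]])%E); last exact: product_measure1E.
by rewrite /= !lebesgue_measure_itv /= !lte_fin ab bb cb -!EFinB -!EFinM.
Qed.

End boxes.

(** * The coboundary of the unbounded function phi *)

Section conjugation_cocycle.
Context {R : realType} (w : weight R).
Hypothesis w_abs : forall u v t : R, w (u, v, t) = w (`|u|, `|v|, 0).
Hypothesis w_lim : forall M : R, exists N : R, forall x y : R,
  0 <= x -> 0 <= y -> N <= x + y -> M <= w (x, y, 0).
Local Notation F := (min_log_weight w).

Definition cylinder : set (L3 R) :=
  ([set` `[- 1, 1]] `*` [set` `[- 1, 1]]) `*` setT.

Lemma cylinderP x : cylinder x <-> `|x.1.1| <= 1 /\ `|x.1.2| <= 1.
Proof.
rewrite /cylinder /= !in_itv /= !ler_norml.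
by split=> [[[]]|[]]; split.
Qed.

Definition potential (x : L3 R) : R := \1_cylinder x * F x.2.

(** With phi for [potential], this is the coboundary d; xg is a conjugate of gx, whence the name. *)
Definition conj_cocycle (g x : L3 R) : R :=
  potential (hmul x g) - potential (hmul g x).

Lemma measurable_conj_cocycle :
  measurable_fun setT (fun z : L3 R * L3 R => conj_cocycle z.1 z.2).
Proof.
have mpot : measurable_fun setT potential.
  apply: measurable_funM.
    apply: measurable_indic; apply: measurableX => //.
    by apply: measurableX; exact: measurable_itv.
  apply: (measurableT_comp (measurable_min_log_weight w_abs)).
  exact: htrd_measurable.
by apply: measurable_funB; apply: (measurableT_comp mpot); exact: hmul_measurable.
Qed.

Lemma conj_cocycleE g x : cylinder (hmul x g) ->
  conj_cocycle g x = F (hmul x g).2 - F (hmul g x).2.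
Proof.
move=> S1; have S2 : cylinder (hmul g x).
  by move: S1; rewrite !cylinderP /= (addrC g.1.1) (addrC g.1.2).
by rewrite /conj_cocycle /potential !indicE !mem_set// !mul1r.
Qed.

(** Off the cylinder both terms vanish. On it the difference is at most ln w(g) <= w(g), and w(x) >=
    1. *)
Lemma conj_cocycle_le g x : `|conj_cocycle g x| <= w g * w x.
Proof.
have [S1|S1] := pselect (cylinder (hmul x g)); last first.
  have S2 : ~ cylinder (hmul g x).
    by move: S1; rewrite !cylinderP /= (addrC g.1.1) (addrC g.1.2).
  rewrite /conj_cocycle /potential !indicE !memNset// !mul0r subrr normr0.
  by rewrite mulr_ge0// ltW ?weight_gt0.
rewrite conj_cocycleE//; apply: (@le_trans _ _ (ln (w g))).
  case: g S1 => -[a b] c; rewrite cylinderP /= => -[pa qb].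
  apply: min_log_weight_dist => //.
  (* The third coordinates of xg and gx differ by x.1.1 b - a x.1.2. In the rewritten form the
     cylinder bounds the factors x.1.1 + a and x.1.2 + b by 1, leaving |a| + |b|. *)
  rewrite (_ : _ - _ = (x.1.1 + a) * b - a * (x.1.2 + b)); last by ring.
  rewrite (le_trans (ler_normB _ _))// !normrM addrC lerD//.
    by rewrite ler_piMr.
  by rewrite ler_piMl.
apply: (@le_trans _ _ (w g)); last by rewrite ler_peMr ?weight_ge1// ltW ?weight_gt0.
rewrite -[X in ln X](subrK 1) addrC (le_trans (le_ln1Dx _))//.
  by rewrite ltrBrDl subrr weight_gt0.
by rewrite gerBl.
Qed.

(** The two occurrences of phi(kxg) on the right cancel. *)
Lemma conj_cocycleM g k x : conj_cocycle (hmul g k) x =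
  conj_cocycle k (hmul x g) + conj_cocycle g (hmul k x).
Proof. by rewrite /conj_cocycle !hmulA addrA subrK. Qed.

Lemma conj_cocycle_unbounded (M : R) : exists a1 a2 a3 b1 b2 b3,
  let A := box a1 a2 a3 in let B := box b1 b2 b3 in
  [/\ (0 < haar A < +oo)%E, (0 < haar B < +oo)%E,
      (forall g x, A g -> B x -> cylinder (hmul x g))
    & (forall g x, A g -> B x -> M <= conj_cocycle g x)].
Proof.
(* [F 0 + ln (w (2, 0, 0))] bounds F on [-2, 2], where the third coordinate of gx will stay. *)
have [T MT] := min_log_weight_infty w_abs w_lim (M + (F 0 + ln (w (2, 0, 0)))).
pose n : R := 2 + 4 * `|T|.
have n2 : 2 <= n by rewrite /n lerDl mulr_ge0.
have nT : 4 * T <= n by rewrite /n; have := ler_norm T; lra.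
have n0 : 0 < n by lra.
have nV : 0 < n^-1 by rewrite invr_gt0.
have nV1 : n^-1 <= 2^-1 by rewrite lef_pV2 ?posrE.
have nn : n^-1 * n = 1 by rewrite mulVf// gt_eqF.
(* Write g = (a, b, c) and x = (p, q, r). The large coordinates b and q nearly cancel: b + q lies in
   [-1/2, 1/2]; also p + a <= 1/2 + 1/n <= 1. The third coordinate of xg contains p b >= n/4 >= |T|,
   whereas that of gx contains a q, which a <= 1/n keeps in [-2, 0]. *)
exists (0, n^-1), (n, n + 2^-1), (0, 1), (4^-1, 2^-1), (- n - 2^-1, - n), (0, 1).
move=> A B.
have AB g x : A g -> B x -> cylinder (hmul x g).
  move=> /boxP[/= /andP[? ?] /andP[? ?] _] /boxP[/= /andP[? ?] /andP[? ?] _].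
  by apply/cylinderP; rewrite /= !ler_norml; split; apply/andP; split; lra.
split=> //.
- by rewrite haar_box/=; [rewrite lte_fin ltry andbT !mulr_gt0; lra|lra|lra|lra].
- by rewrite haar_box/=; [rewrite lte_fin ltry andbT !mulr_gt0; lra|lra|lra|lra].
move=> g x Ag Bx; rewrite (conj_cocycleE (AB g x Ag Bx)).
move: g x Ag Bx => [[a b] c] [[p q] r] /boxP[/=].
move=> /andP[a0 a1] /andP[b0 b1] /andP[c0 c1] /boxP[/=].
move=> /andP[p0 p1] /andP[q0 q1] /andP[r0 r1].
have pb : 4^-1 * n <= p * b by rewrite ler_pM//; lra.
have aq0 : a * q <= 0 by rewrite mulr_ge0_le0//; lra.
have aq2 : - 2 <= a * q.
  have : a * - q <= n^-1 * (n + 2^-1) by rewrite ler_pM//; lra.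
  by rewrite mulrN mulrDr nn; lra.
have F1 : M + (F 0 + ln (w (2, 0, 0))) <= F (r + c + p * b).
  apply: MT; rewrite ger0_norm; lra.
have F2 : F (0 + (c + r + a * q)) <= F 0 + ln (w (2, 0, 0)).
  apply: min_log_weightD => //; rewrite normr0 addr0 (ger0_norm (_ : 0 <= 2))//.
  by rewrite ler_norml; apply/andP; split; lra.
by move: F1 F2; rewrite add0r; lra.
Qed.

End conjugation_cocycle.

(** * The derivation is not inner *)

Section not_inner.
Context {R : realType} (w : weight R).
Hypothesis w_abs : forall u v t : R, w (u, v, t) = w (`|u|, `|v|, 0).
Hypothesis w_lim : forall M : R, exists N : R, forall x y : R,
  0 <= x -> 0 <= y -> N <= x + y -> M <= w (x, y, 0).
Local Notation haarR := (@haar R).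
Local Notation d := (conj_cocycle w).
Local Open Scope quotient_scope.

Let md := measurable_conj_cocycle w_abs.
Let dw := conj_cocycle_le w_abs.

(** The cylinder is not compact, but [w] ignores the central coordinate, so the bound on a compact
    cube carries over. *)
Lemma weight_cylinder_bounded :
  exists2 K : R, 0 < K & forall x, cylinder x -> w x <= K.
Proof.
have [K wK] := weight_bounded w 1; exists (`|K| + 1).
  exact: ltr_pwDr.
move=> [[u v] t] /cylinderP[/= u1 v1]; rewrite w_abs.
apply: (@le_trans _ _ K); last by rewrite ler_wpDr// ler_norm.
by apply: wK; rewrite /= ?normr_id ?normr0.
Qed.

Lemma weight_box_bounded (a b c : R * R) :
  exists K : R, forall x, box a b c x -> w x <= K.
Proof.
have norm_le (p : R * R) (r : R) : p.1 <= r <= p.2 -> `|r| <= `|p.1| + `|p.2|.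
  move=> /andP[p1 p2]; rewrite ler_norml.
  have := ler_norm (- p.1); have := ler_norm p.2; rewrite normrN.
  have := normr_ge0 p.1; have := normr_ge0 p.2.
  by move=> ? ? ? ?; apply/andP; split; lra.
pose N (p : R * R) := `|p.1| + `|p.2|.
have N0 p : 0 <= N p by rewrite addr_ge0.
have [K wK] := weight_bounded w (N a + N b + N c); exists K => x.
have [[Na Nb] Nc] := (N0 a, N0 b, N0 c).
move=> /boxP[/norm_le xa /norm_le xb /norm_le xc]; apply: wK.
- by apply: (le_trans xa); rewrite -/(N a); lra.
- by apply: (le_trans xb); rewrite -/(N b); lra.
- by apply: (le_trans xc); rewrite -/(N c); lra.
Qed.

Lemma conj_cocycle_not_inner (D : L1 w -> dual (L1 w)) :
  (forall f h, D (\pi_(L1 w) f) (\pi_(L1 w) h) = form d f h) ->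
  ~ inner (@L1_mul R w) D.
Proof.
move=> DE [psi Dpsi].
have [C C0 psiC] := dual_bounded psi.
(* In the partial order of the complex numbers, positive elements are real. *)
have [c CE] : exists c : R, C = c%:C%C.
  move: C0; rewrite ltcE => /andP[/eqP] /= IC _; exists (complex.Re C).
  by case: C IC {psiC} => ? ? /= ->.
have c0 : 0 < c by move: C0; rewrite CE ltcR.
have [K K0 wK] := weight_cylinder_bounded.
(* If [D] is inner, its value is a difference of two values of [psi] at convolutions of indicators,
   each at most c 4K |A| |B| in modulus. This explains 8cK; the added 1 gives the contradiction. *)
have [a1 [a2 [a3 [b1 [b2 [b3 [A0 B0 cyl dM]]]]]]] :=
  conj_cocycle_unbounded w_abs w_lim (8 * c * K + 1).
set A := box a1 a2 a3 in A0 cyl dM; set B := box b1 b2 b3 in B0 cyl dM.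
have mA : measurable A by exact: measurable_box.
have mB : measurable B by exact: measurable_box.
have [/andP[A0' Aoo] /andP[B0' Boo]] := (A0, B0).
have arith (p q r : R) : p <= 4 * K * r -> q <= 4 * K * r ->
    c * p + c * q <= 8 * c * K * r.
  move=> pr qr; rewrite [leRHS](_ : _ = c * (4 * K * r + 4 * K * r)); last by ring.
  by rewrite -mulrDr ler_pM2l//; exact: lerD.
have [KA wA] := weight_box_bounded a1 a2 a3.
have [KB wB] := weight_box_bounded b1 b2 b3.
pose f : L1fun w := Build_L1fun (indic_L1 mA Aoo wA).
pose h : L1fun w := Build_L1fun (indic_L1 mB Boo wB).
have pos : 0 < fine (haarR A) * fine (haarR B).
  by rewrite mulr_gt0// fine_gt0// ?A0 ?B0.
have psi_le (u : L1fun w) : Normc.normc (psi (\pi_(L1 w) u)) <= c * wnorm w u.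
  have := psiC (\pi_(L1 w) u).
  by rewrite [`|\pi_(L1 w) u|]L1_norm_pi CE normr_normc -rmorphM lecR.
have upper : Normc.normc (form d f h) <=
    8 * c * K * (fine (haarR A) * fine (haarR B)).
  rewrite -DE Dpsi /lact /ract !L1_mul_pi.
  apply: (le_trans (le_normcD _ _)); rewrite normcN.
  have hf := wnorm_conv_indic mB Boo mA Aoo (erefl : h = _ :> (_ -> _))
    (erefl : f = _ :> (_ -> _)) (fun x g Bx Ag => wK _ (cyl g x Ag Bx)).
  have cyl' g x : A g -> B x -> cylinder (hmul g x).
    move=> Ag Bx; have := cyl g x Ag Bx.
    by rewrite !cylinderP /= (addrC g.1.1) (addrC g.1.2).
  have fh := wnorm_conv_indic mA Aoo mB Boo (erefl : f = _ :> (_ -> _))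
    (erefl : h = _ :> (_ -> _)) (fun g x Ag Bx => wK _ (cyl' g x Ag Bx)).
  rewrite (mulrC (fine (haarR B))) in hf.
  apply: le_trans (arith _ _ _ hf fh).
  exact: lerD (psi_le (L1_conv_fun h f)) (psi_le (L1_conv_fun f h)).
have lower : (8 * c * K + 1) * (fine (haarR A) * fine (haarR B)) <=
    Normc.normc (form d f h).
  (* The modulus is at least the real part, to which the pointwise bound [dM] applies in both
     integrals. *)
  apply: le_trans (le_trans (ler_norm _) (normr_Re_le _)).
  rewrite mulrCA mulrC.
  apply: haar_integral_indic_ge => //; first exact: (cintegrable_form md dw f h).
  move=> g Ag; apply: haar_integral_indic_ge => //.
    exact: (cintegrable_form_inner md dw h g).
  by move=> x Bx; exact: dM.
by have := le_trans lower upper; rewrite leNgt ltr_pM2r// ltrDl ltr01.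
Qed.

End not_inner.

Theorem proposition2p4 (R : realType) (w : weight R) (W : R -> R -> R)
  (w_eq : forall u v t : R, w (u, v, t) = W `|u| `|v|)
  (W_lim : forall M : R, exists N : R, forall x y : R,
    0 <= x -> 0 <= y -> N <= `|(x, y)| -> M <= W x y) :
  ~ weakly_amenable (@L1_mul R w).
Proof.
have w_abs u v t : w (u, v, t) = w (`|u|, `|v|, 0) by rewrite !w_eq !normr_id.
have w_lim M : exists N : R, forall x y : R,
    0 <= x -> 0 <= y -> N <= x + y -> M <= w (x, y, 0).
  (* The norm of a pair is the maximum of the two absolute values, and x + y is at most twice
     that. *)
  have [N NW] := W_lim M; exists (2 * N) => x y x0 y0 Nxy.
  rewrite w_eq !ger0_norm//; apply: NW => //; rewrite prod_normE /= !ger0_norm//.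
  by rewrite le_max; have [xy|xy] := leP x y; apply/orP; [right|left]; lra.
have [D [lD cD dD DE]] := cocycle_derivation (measurable_conj_cocycle w_abs)
  (conj_cocycle_le w_abs) (@conj_cocycleM _ w).
by move=> /(_ D lD cD dD); exact: conj_cocycle_not_inner.
Qed.
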